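(* Let $S$ be a regular Nörlund method with weights $\sigma_{n,k}=\tau_n\sigma_{n-k}$ and assume that $N_n\to\infty$ as $n\to\infty$. Let the family $\mu^{(k)}$, $k\in\mathbb{N}_0$, be in the mean Nevai class $M^{(S)}(\Sigma_{l_a,l_b})$. Let $$\mathrm{d}\bar{\mu}_n=\sum_{k=0}^n\sigma_{n,k}(p_k^{(n-k)}(x))^2\,\mathrm{d}\mu^{(n-k)},\quad \mathrm{d}\lambda_n=\frac{1}{N_n}\sum_{k=0}^n\sigma_{n,k}K_k^{(n-k)}(x,x)\,\mathrm{d}\mu^{(n-k)},\quad \nu_{n+1}=\frac{1}{N_n}\sum_{k=0}^n\sigma_{n,k}\sum_{j=1}^{k+1}\delta_{x_{k+1,j}^{(n-k)}} .$$ Then the sequence $\nu_{n+1}$ converges weakly to the equilibrium measure $\mu_\Sigma$, i.e. to the weak limit of $\bar{\mu}_n$ (which exists), and $$\operatorname*{w-lim}_{n\to\infty}\nu_{n+1}=\operatorname*{w-lim}_{n\to\infty}\lambda_n=\operatorname*{w-lim}_{n\to\infty}\bar{\mu}_n=\mu_\Sigma .$$ In particular, for every continuous function $f:\mathbb{R}\to\mathbb{R}$, $$\lim_{n\to\infty}\frac{1}{N_n}\sum_{k=0}^n\sigma_{n,k}\sum_{j=1}^{k+1}f(x_{k+1,j}^{(n-k)})=\int_{\mathbb{R}}f(x)\,\mathrm{d}\mu_\Sigma .$$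
   Context: Orthogonal polynomials. $\mu^{(k)}$, $k\in\mathbb{N}_0$, is a family of non-negative finite Borel measures on $\mathbb{R}$, each supported on a bounded interval and having infinite support. For each $k$, $p_l^{(k)}$, $l\in\mathbb{N}_0$, is the polynomial of degree $l$ with positive leading coefficient such that $(p_l^{(k)})_{l\ge 0}$ is orthonormal with respect to $\langle f,g\rangle^{(k)}=\int_{\mathbb{R}} f\overline{g}\,\mathrm{d}\mu^{(k)}$. With $p_{-1}^{(k)}=0$ they satisfy $x p_l^{(k)}(x)=b_{l+1}^{(k)}p_{l+1}^{(k)}(x)+a_l^{(k)}p_l^{(k)}(x)+b_l^{(k)}p_{l-1}^{(k)}(x)$ for $l\in\mathbb{N}_0$, with $a_l^{(k)}\in\mathbb{R}$ and $b_{l+1}^{(k)}>0$; by convention $b_0^{(k)}=0$. The Christoffel-Darboux kernel is $K_n^{(k)}(x,y)=\sum_{l=0}^n p_l^{(k)}(x)p_l^{(k)}(y)$. For $n\ge 1$, $x_{n,j}^{(k)}$, $1\le j\le n$, denotes the $j$th smallest root of $p_n^{(k)}$ (the $n$ roots are real and distinct), and $\delta_x$ is the Dirac point measure at $x\in\mathbb{R}$. Regular Nörlund method. A summation method $S$ is an array of weights $\sigma_{n,k}$, $0\le k\le n$, $n\in\mathbb{N}_0$. It is regular if (i) $\sigma_{n,k}\ge 0$ for all $0\le k\le n$; (ii) $\sum_{k=0}^n\sigma_{n,k}=1$ for all $n$; (iii) $\lim_{n\to\infty}\sigma_{n,k}=0$ for every fixed $k\in\mathbb{N}_0$. It is a Nörlund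 method if $\sigma_{n,k}=\tau_n\sigma_{n-k}$ for non-negative sequences $(\sigma_n)_{n\in\mathbb{N}_0}$ and $(\tau_n)_{n\in\mathbb{N}_0}$. For a regular Nörlund method necessarily $\tau_n=(\sum_{k=0}^n\sigma_{n-k})^{-1}>0$, and one sets $N_n=\tau_n\sum_{k=0}^n\frac{1}{\tau_k}$. Mean Nevai class. For a regular summation method $S$, the family $\mu^{(k)}$, $k\in\mathbb{N}_0$, is in $M^{(S)}(\Sigma_{l_a,l_b})$, where $(\Sigma_{l_a,l_b})_{l_a,l_b\in\mathbb{N}_0}$ are real numbers, if (i) $\sup_{n,k\in\mathbb{N}_0}|a_n^{(k)}|<\infty$ and $\sup_{n,k\in\mathbb{N}_0}|b_n^{(k)}|<\infty$; (ii) $\lim_{n\to\infty}\sum_{k=0}^n\sigma_{n,k}|a_{k+l}^{(n-k)}-a_k^{(n-k)}|=0$ and $\lim_{n\to\infty}\sum_{k=0}^n\sigma_{n,k}|b_{k+l}^{(n-k)}-b_k^{(n-k)}|=0$ for all $l\in\mathbb{N}$; (iii) $\lim_{n\to\infty}\sum_{k=0}^n\sigma_{n,k}(a_k^{(n-k)})^{l_a}(b_k^{(n-k)})^{l_b}=\Sigma_{l_a,l_b}$ for all $l_a,l_b\in\mathbb{N}_0$ (a zeroth power equals $1$). *)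

(* Defs.v *)
From HB Require Import structures.
From mathcomp Require Import all_boot all_order all_algebra.
From mathcomp Require Import polyrcf.
From mathcomp Require Import all_classical all_reals all_analysis.
From mathcomp Require Import measurable_realfun.
Import Order.TTheory GRing.Theory Num.Theory.
Import numFieldNormedType.Exports.

Set Implicit Arguments.
Unset Strict Implicit.
Unset Printing Implicit Defensive.

Local Open Scope classical_set_scope.
Local Open Scope ring_scope.

Section measures.
Context {R : realType}.

Definition on_bounded_interval (mu : {measure set R -> \bar R}) : Prop :=
  exists c d : R, mu (~` `[c, d]) = 0%E.

Definition msupport (mu : {measure set R -> \bar R}) : set R :=
  [set x | forall U : set R, open_nbhs x U -> (0 < mu U)%E].

(* The test integrals take values in [\bar R]: for a finite limit [mu], the case
   [f = 1] forces [m n] to be a finite measure for all large [n]. *)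
Definition weak_cvg (m : nat -> {measure set R -> \bar R})
    (mu : {finite_measure set R -> \bar R}) : Prop :=
  forall f : R -> R, continuous f -> (exists M : R, forall x, `|f x| <= M) ->
    (\int[m n]_x (f x)%:E @[n --> \oo] --> \int[mu]_x (f x)%:E)%E.

End measures.

Definition mdensity {R : realType}
    (mu : {measure set R -> \bar R}) (f : R -> R)
    & (forall x, 0 <= f x) & (measurable_fun setT f) :
    set R -> \bar R :=
  fun A => (\int[mu]_(x in A) (f x)%:E)%E.

Section mdensity.
Context {R : realType} (mu : {measure set R -> \bar R}).
Variables (f : R -> R) (f0 : forall x, 0 <= f x).
Variable (mf : measurable_fun setT f).

Local Notation nu := (mdensity mu f0 mf).

Let nu0 : nu set0 = 0%E. Proof. exact: integral_set0. Qed.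

Let nu_ge0 A : (0 <= nu A)%E.
Proof. by apply: integral_ge0 => x _; rewrite lee_fin. Qed.

Let nu_sigma_additive : semi_sigma_additive nu.
Proof.
apply: semi_sigma_additive_nng_induced => [|x]; last by rewrite lee_fin.
exact/measurable_EFinP.
Qed.

HB.instance Definition _ :=
  isMeasure.Build _ _ _ nu nu0 nu_ge0 nu_sigma_additive.

End mdensity.

Section orthogonal_polynomials.
Context {R : realType}.
Implicit Types (p : nat -> {poly R}) (a b : nat -> R).

Definition orthonormal_polys (mu : {measure set R -> \bar R})
    p : Prop :=
  [/\ forall l, size (p l) = l.+1,
      forall l, 0 < lead_coef (p l) &
      forall l m, (\int[mu]_x ((p l).[x] * (p m).[x])%:E = (l == m)%:R%:E)%E].

Definition recurrence_coefs p a b : Prop :=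
  [/\ b 0 = 0,
      forall l, 0 < b l.+1 &
      forall l (x : R), x * (p l).[x] =
        b l.+1 * (p l.+1).[x] + a l * (p l).[x] +
        b l * (if l is m.+1 then (p m).[x] else 0)].

Definition cd_kernel p n (x y : R) : R :=
  \sum_(l < n.+1) (p l).[x] * (p l).[y].

(* The [j]th smallest root of [p n], for [1 <= j <= n]; [rootsR] lists the
   distinct real roots in increasing order. *)
Definition op_zero p n j : R := (rootsR (p n))`_j.-1.

Lemma poly_sqr_ge0 (q : {poly R}) x : 0 <= q.[x] ^+ 2.
Proof. exact: sqr_ge0. Qed.

Lemma measurable_horner (q : {poly R}) :
  measurable_fun setT (horner q).
Proof. by apply: continuous_measurable_fun; exact: continuous_horner. Qed.

Lemma measurable_poly_sqr (q : {poly R}) :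
  measurable_fun setT (fun x => q.[x] ^+ 2).
Proof. by apply: measurable_funX; exact: measurable_horner. Qed.

Lemma cd_kernel_ge0 p n x : 0 <= cd_kernel p n x x.
Proof. by apply: sumr_ge0 => l _; rewrite -expr2 sqr_ge0. Qed.

Lemma measurable_cd_kernel p n :
  measurable_fun setT (fun x => cd_kernel p n x x).
Proof.
apply: measurable_sum => l.
by apply: measurable_funM; exact: measurable_horner.
Qed.

End orthogonal_polynomials.

Section summation.
Context {R : realType}.
Implicit Types (s : nat -> nat -> R) (tau sg : nat -> {nonneg R}).

Definition regular_method s : Prop :=
  [/\ forall n k, (k <= n)%N -> 0 <= s n k,
      forall n, \sum_(k < n.+1) s n k = 1 &
      forall k, s n k @[n --> \oo] --> 0].

Definition norlund_weight tau sg n k : {nonneg R} :=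
  ((tau n)%:num * (sg (n - k)%N)%:num)%:nng.

Lemma norlund_mean_ge0 tau n :
  0 <= (tau n)%:num * \sum_(k < n.+1) (tau k)%:num^-1.
Proof. by rewrite mulr_ge0// sumr_ge0// => k _; rewrite invr_ge0. Qed.

Definition norlund_mean tau n : {nonneg R} := NngNum (norlund_mean_ge0 tau n).

(* [a k n] and [b k n] stand for $a_n^{(k)}$ and $b_n^{(k)}$. *)
Definition mean_nevai_class s (Sigma : nat -> nat -> R) (a b : nat -> nat -> R)
    : Prop :=
  [/\ (exists M : R, forall n k, `|a k n| <= M) /\
      (exists M : R, forall n k, `|b k n| <= M),
      forall l, (0 < l)%N ->
        ((\sum_(k < n.+1) s n k * `|a (n - k)%N (k + l)%N - a (n - k)%N k|)
           @[n --> \oo] --> 0) /\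
        ((\sum_(k < n.+1) s n k * `|b (n - k)%N (k + l)%N - b (n - k)%N k|)
           @[n --> \oo] --> 0) &
      forall la lb,
        (\sum_(k < n.+1) s n k * (a (n - k)%N k ^+ la * b (n - k)%N k ^+ lb))
          @[n --> \oo] --> Sigma la lb].

End summation.

Section averaged_measures.
Context {R : realType}.
Variable (mu : nat -> {finite_measure set R -> \bar R}).
Variables (p : nat -> nat -> {poly R}) (tau sg : nat -> {nonneg R}).

Definition mean_sqr_measure (n : nat) : {measure set R -> \bar R} :=
  msum (fun k => mscale (norlund_weight tau sg n k)
    (mdensity (mu (n - k)%N) (poly_sqr_ge0 (p (n - k)%N k))
                             (measurable_poly_sqr (p (n - k)%N k)))) n.+1.

Definition mean_cd_measure (n : nat) : {measure set R -> \bar R} :=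
  mscale ((norlund_mean tau n)%:num^-1)%:nng
    (msum (fun k => mscale (norlund_weight tau sg n k)
      (mdensity (mu (n - k)%N) (cd_kernel_ge0 (p (n - k)%N) k)
                               (measurable_cd_kernel (p (n - k)%N) k))) n.+1).

(* [mean_zero_measure n] is the measure $\nu_{n+1}$. *)
Definition mean_zero_measure (n : nat) : {measure set R -> \bar R} :=
  mscale ((norlund_mean tau n)%:num^-1)%:nng
    (msum (fun k => mscale (norlund_weight tau sg n k)
      (msum (fun i => dirac (op_zero (p (n - k)%N) k.+1 i.+1)) k.+1)) n.+1).

End averaged_measures.

(* Main.v *)
Require Import Defs.
From HB Require Import structures.
From mathcomp Require Import all_boot all_order all_algebra.
From mathcomp Require Import polyrcf ring lra zify.
From mathcomp Require Import all_classical all_reals all_analysis.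
From mathcomp Require Import measurable_realfun.
Import Order.TTheory GRing.Theory Num.Theory.
Import numFieldNormedType.Exports.

(** Let [J] be the Jacobi matrix of one of the measures: it is the tridiagonal
    matrix of multiplication by [x] in the basis of the orthonormal polynomials,
    so the [m]-th moment of [(p k) ^ 2 dmu] is the diagonal entry [(J ^ m) k k].
    The proof reads every quantity off such entries.

    Existence of the equilibrium measure.  [(J ^ m) k k] is a polynomial in the
    coefficients [a l], [b l] with [l] within [m] of [k].  By the second condition
    of the mean Nevai class all these indices may be moved to a common one at the
    price of an error that vanishes in the average; what remains is a fixed
    polynomial in [a k] and [b k], whose average converges by the third condition
    ([mean_moment_cvg]).  All measures involved live on one interval [[-C, C]],
    because bounded coefficients bound [J] ([tame_of_bounded_coefs]).  By the
    Weierstrass theorem convergence of the moments gives convergence of the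
    integrals of all continuous functions ([mean_moments_is_cvg]), and the limit
    functional is integration against a measure ([riesz]).

    The Christoffel-Darboux averages.  Summing along the antidiagonals of the
    index triangle shows that [lambda_n] is itself a weighted average of
    [mubar_0, ..., mubar_n] ([cesaro_weight_sum]), with weights that form a regular
    method since [N_n] tends to infinity.  So it has the same limit ([toeplitz]).

    The zeros.  The zeros of [p k.+1] are the eigenvalues of the truncation [J_k]
    of [J], hence the sum of their [m]-th powers is the trace of [J_k ^ m]
    ([sum_op_zero_pow]).  Truncation changes only the last [m] diagonal entries of
    [J ^ m], so this trace differs from the sum of the first [k.+1] diagonal entries
    of [J ^ m], which is a moment of the Christoffel-Darboux density, by a constant
    that depends only on [m] ([trace_jacobi_mx_pow]).  Division by [N_n] makes the
    difference vanish, and the Weierstrass theorem concludes again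
    ([mean_moments_cvg]). *)

Set Implicit Arguments.
Unset Strict Implicit.
Unset Printing Implicit Defensive.

Local Open Scope classical_set_scope.
Local Open Scope ring_scope.

(** * Polynomial approximation on an interval *)
Section weierstrass.
Context {R : realType}.
Implicit Types (f : R -> R) (C e x y : R).

(** Uniform continuity provides [e] for close points, boundedness provides the
    quadratic term for the others.  This shape of modulus can be averaged: the
    mean of the quadratic term is a variance. *)
Lemma continuous_quadratic_modulus f C e : continuous f -> 0 <= C -> 0 < e ->
  exists2 K : R, 0 <= K & forall x y, `|x| <= C -> `|y| <= C ->
    `|f x - f y| <= e + K * (x - y) ^+ 2.
Proof.
move=> cf C0 e0.
have NCC : - C <= C by rewrite lerNl (le_trans _ C0)// lerNl oppr0.
have cf' : {within `[- C, C], continuous (fun x => `|f x|)}.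
  by apply: continuous_subspaceT => x; apply: cvg_norm; exact: cf.
have [c _ fc] := EVT_max NCC cf'.
have inC x : `|x| <= C -> x \in `[- C, C] by rewrite in_itv/= ler_norml.
have /compact_near_coveringP cov := @segment_compact R (- C) C.
have : \forall d \near (0:R)^'+, `[- C, C] `<=`
    (fun x => forall y, `|x - y| < d -> `|f x - f y| <= e).
  apply: cov => x _.
  have /(@cvgrPdist_lt _ R^o _ _ (nbhs_filter x)) /(_ (e / 2)) := cf x.
  rewrite divr_gt0// => /(_ isT) [r /= r0 rP].
  exists (ball x (r / 2), [set d | d < r / 2]).
    split => /=; first by apply: nbhsx_ballx; rewrite divr_gt0.
    by apply: nbhs_right_lt; rewrite divr_gt0.
  move=> [z d]/= [xz dr] y zy.
  have xz' : `|x - z| < r.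
    by rewrite (lt_le_trans xz)// ler_pdivrMr// ler_peMr// ?ler1n// ltW.
  have xy' : `|x - y| < r.
    rewrite (_ : x - y = (x - z) + (z - y)); last by ring.
    rewrite (le_lt_trans (ler_normD _ _))// [ltRHS]splitr ltrD//.
    exact: lt_trans zy dr.
  have := rP z xz'; have := rP y xy'; rewrite /= => A1 A2.
  rewrite (_ : f z - f y = (f x - f y) - (f x - f z)); last by ring.
  by rewrite (le_trans (ler_normB _ _))// [leRHS]splitr lerD// ltW.
move=> /filterI /(_ (nbhs_right_gt 0)) /filter_ex [d0' [Pd' d0'']] {cov}.
have [d Pd d0] : exists2 d : R, `[- C, C] `<=`
    (fun x => forall y, `|x - y| < d -> `|f x - f y| <= e) & 0 < d.
  by exists d0'.
have M0 : 0 <= `|f c| by [].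
exists (2 * `|f c| / d ^+ 2) => [|x y /inC xC /inC yC].
  by apply: divr_ge0; rewrite ?sqr_ge0// mulr_ge0.
have [xyd|dxy] := ltP `|x - y| d.
  rewrite (le_trans (Pd _ xC _ xyd))// lerDl mulr_ge0 ?sqr_ge0//.
  by apply: divr_ge0; rewrite ?sqr_ge0// mulr_ge0.
apply: (@le_trans _ _ (2 * `|f c|)).
  rewrite (le_trans (ler_normB _ _))// mulr_natl mulr2n.
  by apply: lerD; apply: fc.
rewrite -[leLHS]add0r; apply: lerD; first exact: ltW.
rewrite -[leLHS]mulr1 -[leRHS]mulrA ler_wpM2l ?mulr_ge0//.
rewrite mulrC ler_pdivlMr ?exprn_gt0// mul1r.
by rewrite -[leRHS]real_normK ?num_real// lerXn2r ?nnegrE ?(ltW d0).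
Qed.

(** The Bernstein polynomial of [g]: its value at [x] is the expectation of [g] at
    the number of successes in [n] independent trials of success probability [x].
    Conditioning on the first trial replaces binomial sums by an induction. *)
Fixpoint bernstein (n : nat) (g : nat -> R) : {poly R} :=
  if n is n'.+1 then 'X * bernstein n' (g \o S) + (1 - 'X) * bernstein n' g
  else (g 0)%:P.

Lemma bernsteinS n (g : nat -> R) x : (bernstein n.+1 g).[x] =
  x * (bernstein n (g \o S)).[x] + (1 - x) * (bernstein n g).[x].
Proof. by rewrite /= !hornerE. Qed.

Lemma bernstein_le n (g h : nat -> R) x : 0 <= x <= 1 ->
  (forall k, (k <= n)%N -> g k <= h k) -> (bernstein n g).[x] <= (bernstein n h).[x].
Proof.
move=> /andP[x0 x1]; elim: n g h => [|n IH] g h gh.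
  by rewrite /= !hornerC gh.
rewrite !bernsteinS lerD// ler_wpM2l// ?subr_ge0//; apply: IH => k kn.
  exact: gh.
by apply: gh; exact: leqW.
Qed.

Lemma bernsteinD n (g h : nat -> R) c x :
  (bernstein n (fun k => c * g k + h k)).[x] =
  c * (bernstein n g).[x] + (bernstein n h).[x].
Proof.
elim: n g h => [|n IH] g h; first by rewrite /= !hornerC.
by rewrite !bernsteinS !IH; ring.
Qed.

(** Variance plus squared bias.  The centre [c] has to be arbitrary for the
    induction, since a success in the first trial shifts it by one. *)
Lemma bernstein_sqr n c x : (bernstein n (fun k => (k%:R - c) ^+ 2)).[x] =
  n%:R * x * (1 - x) + (n%:R * x - c) ^+ 2.
Proof.
elim: n c => [|n IH] c; first by rewrite /= hornerC; ring.
have -> : bernstein n.+1 (fun k => (k%:R - c) ^+ 2) =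
    'X * bernstein n (fun k => (k%:R - (c - 1)) ^+ 2) +
    (1 - 'X) * bernstein n (fun k => (k%:R - c) ^+ 2).
  rewrite /=; congr (_ * bernstein _ _ + _); apply/funext => k /=.
  by rewrite -natr1; congr (_ ^+ 2); ring.
by rewrite !hornerE /= !IH -natr1; ring.
Qed.

Lemma bernstein_cst n c x : (bernstein n (fun=> c)).[x] = c.
Proof.
by elim: n => [|n IH]; rewrite ?bernsteinS /= ?hornerC// IH; ring.
Qed.

(** The quadratic modulus bounds the error of the Bernstein polynomial by
    [e / 2] plus a variance, which is of order [1 / n]. *)
Lemma weierstrass f C e : continuous f -> 0 < C -> 0 < e ->
  exists q : {poly R}, forall x, `|x| <= C -> `|f x - q.[x]| <= e.
Proof.
move=> cf C0 e0.
have e20 : 0 < e / 2 by rewrite divr_gt0.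
have [K K0 Kf] := continuous_quadratic_modulus cf (ltW C0) e20.
have [n nE n0] : exists2 n : nat,
    K * (2 * C) ^+ 2 / (e / 2) < n%:R & (0:R) < n%:R.
  exists (Num.truncn (K * (2 * C) ^+ 2 / (e / 2))).+1; first exact: truncnS_gt.
  by rewrite ltr0n.
have C20 : 0 < 2 * C by rewrite mulr_gt0.
pose pt (k : nat) : R := 2 * C * (k%:R / n%:R) - C.
exists (bernstein n (f \o pt) \Po ((2 * C)^-1 *: ('X + C%:P))) => x xC.
rewrite horner_comp !hornerE.
(* [t] is the image of [x] under the affine map of [[-C, C]] onto [[0, 1]], and
   [pt k] is the preimage of [k / n]. *)
set t := (2 * C)^-1 * (x + C).
have xE : x = 2 * C * t - C by rewrite /t mulVKf ?gt_eqF//; ring.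
have /andP[t0 t1] : 0 <= t <= 1.
  move: xC; rewrite ler_norml => /andP[x1 x2]; rewrite /t mulr_ge0 /=.
  - by rewrite ler_pdivrMl// mulr1; lra.
  - by rewrite invr_ge0 ltW.
  - by lra.
have bd k : (k <= n)%N -> `|f x - f (pt k)| <=
    e / 2 + K * (2 * C) ^+ 2 / n%:R ^+ 2 * (k%:R - n%:R * t) ^+ 2.
  move=> kn; apply: le_trans (Kf _ _ xC _) _.
    have : 0 <= (k%:R / n%:R : R) <= 1.
      by rewrite divr_ge0//= ler_pdivrMr// mul1r ler_nat.
    rewrite /pt ler_norml; set u := k%:R / _ => /andP[u0 u1]; nra.
  rewrite lerD2l le_eqVlt; apply/orP; left; apply/eqP.
  rewrite {1}xE /pt; field; by rewrite gt_eqF.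
have var : e / 2 + K * (2 * C) ^+ 2 / n%:R ^+ 2 * (n%:R * t * (1 - t)) <= e.
  rewrite [leRHS]splitr lerD2l.
  apply: (@le_trans _ _ (K * (2 * C) ^+ 2 / n%:R)).
    rewrite -[leRHS]mulr1 expr2 invfM.
    rewrite (_ : _ * _ * _ = K * (2 * C) ^+ 2 / n%:R * (t * (1 - t))); last first.
      by field; rewrite gt_eqF.
    rewrite ler_wpM2l//; last by nra.
    by rewrite divr_ge0// mulr_ge0 ?sqr_ge0.
  rewrite ler_pdivrMr//; move/ltW: nE; rewrite ler_pdivrMr// => /le_trans; apply.
  by rewrite mulrC.
set D := K * _ / _ in bd var.
have bE : (bernstein n (fun k => D * (k%:R - n%:R * t) ^+ 2 + e / 2)).[t] =
    D * (n%:R * t * (1 - t)) + e / 2.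
  by rewrite bernsteinD bernstein_sqr bernstein_cst subrr expr0n addr0.
rewrite ler_norml; apply/andP; split.
- rewrite lerBrDl -lerBrDr opprK.
  rewrite addrC -[X in X <= _](_ : (bernstein n (f \o pt)).[t] = _) //.
  apply: le_trans (_ : _ <= (bernstein n (fun k =>
    1 * (D * (k%:R - n%:R * t) ^+ 2 + e / 2) + f x)).[t]) _.
    apply: bernstein_le; first by rewrite t0.
    by move=> k /bd; rewrite ler_norml => /andP[h1 h2] /=; lra.
  rewrite bernsteinD bE bernstein_cst; lra.
- rewrite lerBlDl -lerBlDr.
  apply: le_trans (_ : (bernstein n (fun k =>
    (-1) * (D * (k%:R - n%:R * t) ^+ 2 + e / 2) + f x)).[t] <= _).
    rewrite bernsteinD bE bernstein_cst; lra.
  apply: bernstein_le; first by rewrite t0.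
  by move=> k /bd; rewrite ler_norml => /andP[h1 h2] /=; lra.
Qed.

End weierstrass.

(** * Means: positive normalized functionals on continuous functions *)
Section means.
Context {R : realType}.
Implicit Types (f g : R -> R) (C : R) (Phi : (R -> R) -> R).

(** What remains of a probability measure on [[-C, C]] when only integrals of
    continuous functions matter.  Integrals, averages over zeros and limits of
    either are compared in this form. *)
Definition mean_on C Phi :=
  [/\ forall c f g, continuous f -> continuous g ->
        Phi (fun x => c * f x + g x) = c * Phi f + Phi g,
      Phi (cst 1) = 1 &
      forall f, continuous f -> (forall x, `|x| <= C -> 0 <= f x) ->
        0 <= Phi f].

Lemma continuous_lin c f g : continuous f -> continuous g ->
  continuous (fun x : R => c * f x + g x).
Proof.
move=> cf cg x; apply: (@cvgD _ R^o); last exact: cg.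
by apply: cvgM; [exact: cvg_cst|exact: cf].
Qed.

Lemma continuous_cst (c : R) : continuous (cst c : R -> R).
Proof. by move=> x; exact: cvg_cst. Qed.

Lemma continuous_expr m : continuous (fun x : R => x ^+ m).
Proof. exact: exprn_continuous. Qed.

Lemma cvg_sumr n (u : 'I_n -> nat -> R) (l : 'I_n -> R) :
  (forall i, u i k @[k --> \oo] --> l i) ->
  \sum_(i < n) u i k @[k --> \oo] --> \sum_(i < n) l i.
Proof.
move=> ul; apply: (@cvg_big _ _ _ _ _ _ _ \oo _ u) => //.
exact: add_continuous.
Qed.

Section one_mean.
Variables (C : R) (Phi : (R -> R) -> R).
Hypothesis mPhi : mean_on C Phi.

Let lin := let: And3 l _ _ := mPhi in l.
Let one := let: And3 _ o _ := mPhi in o.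
Let pos := let: And3 _ _ p := mPhi in p.

Lemma mean0 : Phi (cst 0) = 0.
Proof.
have -> : cst 0 = (fun x : R => - 1 * cst 1 x + cst 1 x) :> (R -> R).
  by apply/funext => x /=; rewrite mulN1r addNr.
by rewrite lin ?one ?mulN1r ?addNr//; exact: continuous_cst.
Qed.

Lemma meanZ c f : continuous f -> Phi (fun x => c * f x) = c * Phi f.
Proof.
move=> cf; rewrite -[RHS]addr0 -mean0 -lin//; last exact: continuous_cst.
by congr Phi; apply/funext => x /=; rewrite addr0.
Qed.

Lemma mean_cst c : Phi (cst c) = c.
Proof.
rewrite -[RHS]mulr1 -one -meanZ; last exact: continuous_cst.
by congr Phi; apply/funext => x /=; rewrite mulr1.
Qed.

Lemma meanD f g : continuous f -> continuous g ->
  Phi (fun x => f x + g x) = Phi f + Phi g.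
Proof.
move=> cf cg; rewrite -[X in X + _]mul1r -lin//.
by congr Phi; apply/funext => x /=; rewrite mul1r.
Qed.

Lemma mean_le f g : continuous f -> continuous g ->
  (forall x, `|x| <= C -> f x <= g x) -> Phi f <= Phi g.
Proof.
move=> cf cg fg; rewrite -subr_ge0 addrC -mulN1r -lin//.
apply: pos; first exact: continuous_lin.
by move=> x xC; rewrite mulN1r addrC subr_ge0 fg.
Qed.

Lemma mean_dist f g (e : R) : continuous f -> continuous g ->
  (forall x, `|x| <= C -> `|f x - g x| <= e) -> `|Phi f - Phi g| <= e.
Proof.
move=> cf cg fg.
have De (h : R -> R) : continuous h -> Phi (fun x => h x + e) = Phi h + e.
  by move=> ch; rewrite meanD ?mean_cst//; exact: continuous_cst.
have cDe (h : R -> R) : continuous h -> continuous (fun x => h x + e).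
  by move=> ch x; apply: (@cvgD _ R^o); [exact: ch|exact: cvg_cst].
have le1 h k : continuous h -> continuous k ->
    (forall x, `|x| <= C -> `|h x - k x| <= e) -> Phi h <= Phi k + e.
  move=> ch ck hk; rewrite -De//; apply: mean_le => // [|x /hk]; first exact: cDe.
  by rewrite ler_norml => /andP[]; lra.
have := le1 _ _ cf cg fg; have := le1 _ _ cg cf.
have gf x : `|x| <= C -> `|g x - f x| <= e by rewrite distrC; exact: fg.
by move=> /(_ gf) ? ?; rewrite ler_norml; apply/andP; split; lra.
Qed.

Lemma mean_eq f g : continuous f -> continuous g ->
  (forall x, `|x| <= C -> f x = g x) -> Phi f = Phi g.
Proof.
move=> cf cg fg; apply/eqP; rewrite -subr_eq0 -normr_le0.
by apply: mean_dist => // x xC; rewrite fg// subrr normr0.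
Qed.

Lemma mean_sum n (c : nat -> R) (h : nat -> R -> R) :
  (forall i, continuous (h i)) ->
  continuous (fun x => \sum_(i < n) c i * h i x) /\
  Phi (fun x => \sum_(i < n) c i * h i x) = \sum_(i < n) c i * Phi (h i).
Proof.
move=> ch; elim: n => [|n [cIH IH]].
  have -> : (fun x => \sum_(i < 0) c i * h i x) = cst 0.
    by apply/funext => x; rewrite big_ord0.
  by rewrite big_ord0 mean0; split => //; exact: continuous_cst.
have -> : (fun x => \sum_(i < n.+1) c i * h i x) =
          (fun x => c n * h n x + \sum_(i < n) c i * h i x).
  by apply/funext => x; rewrite big_ord_recr addrC.
split; first exact: continuous_lin.
by rewrite lin// IH big_ord_recr addrC.
Qed.

Lemma mean_poly (q : {poly R}) :
  Phi (horner q) = \sum_(i < size q) q`_i * Phi (fun x => x ^+ i).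
Proof.
rewrite -(mean_sum (size q) (fun i => q`_i) continuous_expr).2.
by congr Phi; apply/funext => x; rewrite horner_coef.
Qed.

Lemma mean_onW C' : C <= C' -> mean_on C' Phi.
Proof.
move=> CC'; split => // f cf f0; apply: pos => // x xC; apply: f0.
exact: le_trans CC'.
Qed.

End one_mean.

(** Method of moments: on polynomials the difference tends to zero by linearity,
    and a uniform approximation on [[-C, C]] costs the same for every mean. *)
Lemma mean_moments_cvg C (Phi Psi : nat -> (R -> R) -> R) : 0 < C ->
  (forall n, mean_on C (Phi n)) -> (forall n, mean_on C (Psi n)) ->
  (forall m, Phi n (fun x => x ^+ m) - Psi n (fun x => x ^+ m)
     @[n --> \oo] --> 0) ->
  forall f, continuous f -> Phi n f - Psi n f @[n --> \oo] --> 0.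
Proof.
move=> C0 mPhi mPsi mom f cf.
apply/cvgrPdist_le => e e0; have e4 : 0 < e / 4 by rewrite divr_gt0.
have [q qf] := weierstrass cf C0 e4.
have qcvg : Phi n (horner q) - Psi n (horner q) @[n --> \oo] --> 0.
  have -> : (fun n => Phi n (horner q) - Psi n (horner q)) =
    (fun n => \sum_(i < size q) q`_i *
       (Phi n (fun x => x ^+ i) - Psi n (fun x => x ^+ i))).
    apply/funext => n; rewrite !(mean_poly (mPhi _)) !(mean_poly (mPsi _)).
    by rewrite -sumrB; apply: eq_bigr => i _; rewrite mulrBr.
  rewrite [X in _ --> X](_ : 0 = \sum_(i < size q) q`_i * 0); last first.
    by rewrite big1// => i _; rewrite mulr0.
  by apply: cvg_sumr => i; apply: cvgMr; exact: mom.
move/cvgrPdist_le : qcvg => /(_ _ e4); apply: filterS => n.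
rewrite !sub0r !normrN => qn.
have cq := @continuous_horner _ q.
have := mean_dist (mPhi n) cf cq qf; have := mean_dist (mPsi n) cf cq qf.
move: qn; rewrite !ler_norml => /andP[? ?] /andP[? ?] /andP[? ?].
by apply/andP; split; lra.
Qed.

Lemma mean_moments_is_cvg C (Phi : nat -> (R -> R) -> R) : 0 < C ->
  (forall n, mean_on C (Phi n)) ->
  (forall m, cvgn (fun n => Phi n (fun x => x ^+ m))) ->
  forall f, continuous f -> cvgn (fun n => Phi n f).
Proof.
move=> C0 mPhi mom f cf.
apply/cauchy_cvgP/cauchy_exP => e e0; have e3 : 0 < e / 3 by rewrite divr_gt0.
have [q qf] := weierstrass cf C0 e3.
have qcvg : cvgn (fun n => Phi n (horner q)).
  have -> : (fun n => Phi n (horner q)) =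
    (fun n => \sum_(i < size q) q`_i * Phi n (fun x => x ^+ i)).
    by apply/funext => n; rewrite (mean_poly (mPhi _)).
  apply/cvg_ex.
  exists (\sum_(i < size q) q`_i * limn (fun n => Phi n (fun x => x ^+ i))).
  by apply: cvg_sumr => i; apply: cvgMr; exact: mom.
exists (limn (fun n => Phi n (horner q))).
move/cvgrPdist_le : qcvg => /(_ _ e3); apply: filterS => n /= qn.
rewrite /ball/=.
have := mean_dist (mPhi n) cf (@continuous_horner _ q) qf.
move: qn; rewrite ler_norml ler_norml ltr_norml => /andP[? ?] /andP[? ?].
by apply/andP; split; lra.
Qed.

Lemma mean_lim C (Phi : nat -> (R -> R) -> R) :
  (forall n, mean_on C (Phi n)) ->
  (forall f, continuous f -> cvgn (fun n => Phi n f)) ->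
  mean_on C (fun f => limn (fun n => Phi n f)).
Proof.
move=> mPhi cPhi; split => [c f g cf cg||f cf f0].
- apply/cvg_lim => //.
  under eq_fun do rewrite (let: And3 l _ _ := mPhi _ in l) //.
  apply: cvgD; last exact: cPhi.
  by apply: cvgMr; exact: cPhi.
- apply/cvg_lim => //; under eq_fun do rewrite (let: And3 _ o _ := mPhi _ in o).
  exact: cvg_cst.
- apply: limr_ge; first exact: cPhi.
  by apply: nearW => n; case: (mPhi n) => _ _; apply.
Qed.

Lemma mean_convex C n (w : nat -> R) (Phi : nat -> (R -> R) -> R) :
  (forall k, (k < n)%N -> 0 <= w k) -> \sum_(k < n) w k = 1 ->
  (forall k, (k < n)%N -> mean_on C (Phi k)) ->
  mean_on C (fun f => \sum_(k < n) w k * Phi k f).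
Proof.
move=> w0 w1 mPhi; split => [c f g cf cg||f cf f0].
- rewrite mulr_sumr -big_split; apply: eq_bigr => k _ /=.
  by have [-> // _ _] := mPhi k (ltn_ord k); rewrite mulrDr mulrCA.
- rewrite -[RHS]w1; apply: eq_bigr => k _.
  by have [_ -> _] := mPhi k (ltn_ord k); rewrite mulr1.
- apply: sumr_ge0 => k _; rewrite mulr_ge0 ?w0//.
  by have [_ _] := mPhi k (ltn_ord k); apply.
Qed.

End means.

(** * Integrals against multiples, sums and densities *)
Section integrals.
Context {R : realType}.
Implicit Types (f g : R -> R) (C : R) (mu : {measure set R -> \bar R}).

Lemma continuous_bounded_itv f C : continuous f -> 0 <= C ->
  exists M : R, forall x, `|x| <= C -> `|f x| <= M.
Proof.
move=> cf C0; have [K K0 Kf] := continuous_quadratic_modulus cf C0 ltr01.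
exists (`|f 0| + (1 + K * C ^+ 2)) => x xC.
rewrite -[f x](subrK (f 0)) addrC (le_trans (ler_normD _ _))// lerD2l.
apply: le_trans (Kf _ 0 xC _) _; first by rewrite normr0.
rewrite subr0 lerD2l ler_wpM2l// -[leLHS]real_normK ?num_real//.
by rewrite lerXn2r ?nnegrE.
Qed.

Lemma integrable_continuous mu C f : (mu setT < +oo)%E -> 0 <= C ->
  mu (~` `[- C, C]) = 0%E -> continuous f ->
  mu.-integrable setT (fun x => (f x)%:E).
Proof.
move=> muT C0 muC cf.
have mf := continuous_measurable_fun cf.
have mCC : measurable (~` `[- C, C]%classic : set R).
  by apply: measurableC; exact: measurable_itv.
apply/(@negligible_integrable _ _ _ mu setT _ (EFin \o f) mCC) => //.
  exact/measurable_EFinP.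
rewrite setTD setCK; apply: measurable_bounded_integrable.
- exact: measurable_itv.
- apply: le_lt_trans muT; apply: le_measure; rewrite ?inE//.
- exact: measurable_funTS.
have [M fM] := continuous_bounded_itv cf C0.
exists M; split; first exact: num_real.
move=> y My x /= xC; apply: le_trans (fM _ _) (ltW My).
by move: xC; rewrite in_itv/= ler_norml.
Qed.

Lemma mean_on_integral mu C : 0 <= C -> mu setT = 1%E ->
  mu (~` `[- C, C]) = 0%E -> mean_on C (fun f => \int[mu]_x f x).
Proof.
move=> C0 mu1 muC.
have muT : (mu setT < +oo)%E by rewrite mu1 ltry.
have intf f := @integrable_continuous mu C f muT C0 muC.
split => [c f g cf cg||f cf f0].
- rewrite RintegralD//; last 2 first.
  + apply: (intf (fun x => c * f x)) => x.
    by apply: cvgM; [exact: cvg_cst|exact: cf].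
  + exact: intf.
  by rewrite RintegralZl//; exact: intf.
- by rewrite Rintegral_cst// mu1 mulr1.
- rewrite /Rintegral (@negligible_integral _ _ _ mu setT (~` `[- C, C])) //.
  + rewrite setTD setCK; apply: Rintegral_ge0 => x.
    by rewrite /= in_itv/= -ler_norml => /f0.
  + by apply: measurableC; exact: measurable_itv.
  + exact: intf.
Qed.

(** Additivity in the measure holds for nonnegative integrands; integrability
    allows the subtraction of the negative part. *)
Lemma integral_mscale_msum (nu : nat -> {measure set R -> \bar R})
    (w : nat -> {nonneg R}) n f :
  (forall k, (k < n)%N -> (nu k).-integrable setT (fun x => (f x)%:E)) ->
  (\int[msum (fun k => mscale (w k) (nu k)) n]_x (f x)%:E)%E =
  (\sum_(k < n) (w k)%:num * \int[nu k]_x f x)%:E.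
Proof.
move=> intf.
have mf : forall k, (k < n)%N -> measurable_fun setT (EFin \o f).
  by move=> k /intf /measurable_int.
have [->|n0] := posnP n.
  by rewrite msum_mzero integral_measure_zero big_ord0.
have {}mf : measurable_fun setT (EFin \o f) by exact: (mf 0%N).
have partE (h : R -> \bar R) : measurable_fun setT h -> (forall x, 0 <= h x)%E ->
  (forall k, (k < n)%N -> \int[nu k]_x h x \is a fin_num)%E ->
  (\int[msum (fun k => mscale (w k) (nu k)) n]_x h x)%E =
  (\sum_(k < n) (w k)%:num * fine (\int[nu k]_x h x))%:E.
  move=> mh h0 hfin; rewrite ge0_integral_measure_sum// -sumEFin.
  apply: eq_bigr => k _; rewrite ge0_integral_mscale//.
  by rewrite EFinM fineK// hfin.
have fp k : (k < n)%N -> (\int[nu k]_x ((EFin \o f)^\+ x) \is a fin_num)%E.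
  by move=> /intf; exact: integrable_pos_fin_num.
have fn k : (k < n)%N -> (\int[nu k]_x ((EFin \o f)^\- x) \is a fin_num)%E.
  by move=> /intf; exact: integrable_neg_fin_num.
rewrite integralE partE//; last exact: measurable_funepos.
rewrite partE//; last exact: measurable_funeneg.
rewrite -EFinB -sumrB; congr EFin; apply: eq_bigr => k _.
rewrite -mulrBr; congr (_ * _).
rewrite /Rintegral [in RHS]integralE.
by rewrite (fineB (fp k (ltn_ord k)) (fn k (ltn_ord k))).
Qed.

Import HBNNSimple.

(** For indicator functions this is the definition of the density; simple
    functions and monotone convergence extend it. *)
Lemma ge0_integral_mdensity mu (f : R -> R) (f0 : forall x, 0 <= f x)
    (mf : measurable_fun setT f) (g : R -> \bar R) :
  measurable_fun setT g -> (forall x, 0 <= g x)%E ->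
  (\int[mdensity mu f0 mf]_x g x = \int[mu]_x (g x * (f x)%:E))%E.
Proof.
move=> mg g0.
have mfE : measurable_fun setT (EFin \o f) by exact/measurable_EFinP.
pose h := nnsfun_approx measurableT mg.
have hcvg x : (EFin \o h n) x @[n --> \oo] --> g x.
  by apply: cvg_nnsfun_approx.
have -> : (\int[mdensity mu f0 mf]_x g x =
    limn (fun n => \int[mdensity mu f0 mf]_x (EFin \o h n) x))%E.
  under eq_integral => x _ do rewrite -(cvg_lim _ (hcvg x))//.
  apply: monotone_convergence => //.
  - by move=> n; exact/measurable_EFinP.
  - by move=> n x _ /=; rewrite lee_fin.
  - by move=> x _ a b ab; rewrite lee_fin; exact/lefP/nd_nnsfun_approx.
have -> : (\int[mu]_x (g x * (f x)%:E) =
    limn (fun n => \int[mu]_x ((EFin \o h n) x * (f x)%:E)))%E.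
  under eq_integral => x _.
    rewrite -(_ : (limn (fun n => (EFin \o h n) x * (f x)%:E)) =
                  g x * (f x)%:E)%E; last first.
      by apply/cvg_lim => //; apply: cvgeZr => //; exact: hcvg.
    over.
  apply: monotone_convergence => //.
  - move=> n; apply/emeasurable_funM => //; exact/measurable_EFinP.
  - by move=> n x _ /=; rewrite mule_ge0 ?lee_fin.
  - move=> x _ a b ab /=; rewrite lee_wpmul2r ?lee_fin//.
    exact/lefP/nd_nnsfun_approx.
congr (limn _); apply/funext => n /=.
transitivity (\int[mdensity mu f0 mf]_x
   (\sum_(y \in range (h n)) (y * \1_(h n @^-1` [set y]) x)%:E))%E.
  by apply: eq_integral => t _; rewrite /= fimfunE -fsumEFin.
have indich m r : measurable_fun setT (fun x => (r * \1_(h m @^-1` [set r]) x)%:E).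
  by apply: (measurable_comp measurableT) => //; exact: measurable_funM.
rewrite ge0_integral_fsum//; last by move=> m y _; exact: nnfun_muleindic_ge0.
transitivity (\int[mu]_x (\sum_(y \in range (h n))
    (y * \1_(h n @^-1` [set y]) x)%:E * (f x)%:E))%E; last first.
  under eq_integral => x _.
    rewrite -ge0_mule_fsuml => [|y]; last exact: nnfun_muleindic_ge0.
    rewrite fsumEFin // -(fimfunE _ x); over.
  by [].
rewrite ge0_integral_fsum//; last 2 first.
  - by move=> y; apply: emeasurable_funM.
  - move=> m y _; apply: mule_ge0; last by rewrite lee_fin.
    by rewrite EFinM nnfun_muleindic_ge0.
apply: eq_fsbigr => r rhn.
under eq_integral do rewrite EFinM.
rewrite integralZl_indic_nnsfun => //.
under [RHS]eq_integral do rewrite EFinM -muleA.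
rewrite ge0_integralZl//.
- under [in RHS]eq_integral do rewrite muleC.
  rewrite [in RHS](eq_integral ((EFin \o f) \_ (h n @^-1` [set r]))); last first.
    by move=> x xE; rewrite epatch_indic.
  by rewrite -integral_mkcond integral_indic// setIT.
- by apply: emeasurable_funM => //; exact/measurable_EFinP.
- by move=> t Et; rewrite mule_ge0 ?lee_fin.
- by move: rhn; rewrite inE => -[t _ <-]; rewrite lee_fin.
Qed.

Lemma integral_mdensity mu (f : R -> R) (f0 : forall x, 0 <= f x)
    (mf : measurable_fun setT f) (g : R -> R) : measurable_fun setT g ->
  (\int[mdensity mu f0 mf]_x (g x)%:E = \int[mu]_x (g x * f x)%:E)%E.
Proof.
move=> mg; have mgE : measurable_fun setT (EFin \o g) by exact/measurable_EFinP.
rewrite integralE [RHS]integralE !ge0_integral_mdensity//; last 2 first.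
  exact: measurable_funeneg.
  exact: measurable_funepos.
congr (_ - _)%E; apply: eq_integral => x _.
- by rewrite !funeposE maxe_pMl ?lee_fin// mul0e.
- by rewrite !funenegE maxe_pMl ?lee_fin// mul0e EFinM mulNe.
Qed.

End integrals.

(** * Representation of means by measures *)
Section riesz.
Context {R : realType}.
Implicit Types (f g : R -> R) (C x y d : R) (Phi Psi : (R -> R) -> R).

(** A continuous function between the indicators of [`]-oo, x]] and
    [`]-oo, x + d]], so that its mean lies between two values of a distribution
    function. *)
Definition ramp x d y : R := Num.max 0 (Num.min 1 ((x + d - y) / d)).

Lemma continuous_ramp x d : continuous (ramp x d).
Proof.
move=> y; apply: (@continuous_max _ _ (cst 0)
  (fun z => Num.min 1 ((x + d - z) / d))); first exact: cvg_cst.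
apply: (@continuous_min _ _ (cst 1) (fun z => (x + d - z) / d)).
  exact: cvg_cst.
apply: cvgM; last exact: cvg_cst.
by apply: (@cvgB _ R^o); [exact: cvg_cst|exact: cvg_id].
Qed.

Lemma ramp_ge0 x d y : 0 <= ramp x d y.
Proof. by rewrite /ramp le_max lexx. Qed.

Lemma ramp_le1 x d y : ramp x d y <= 1.
Proof. by rewrite /ramp ge_max ler01 ge_min lexx. Qed.

Lemma ramp1 x d y : 0 < d -> y <= x -> ramp x d y = 1.
Proof.
move=> d0 yx; have : 1 <= (x + d - y) / d by rewrite ler_pdivlMr//; lra.
by move=> h; rewrite /ramp min_l// max_r.
Qed.

Lemma ramp0 x d y : 0 < d -> x + d <= y -> ramp x d y = 0.
Proof.
move=> d0 yx; have : (x + d - y) / d <= 0 by rewrite ler_pdivrMr// mul0r; lra.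
by move=> h; rewrite /ramp min_r ?(le_trans h)// max_l.
Qed.

(** The means of the continuous majorants of the indicator of [`]-oo, x]]; their
    infimum is the mass that a representing measure must give to this half-line. *)
Definition half_line_bounds Phi x : set R := [set Phi f | f in
  [set f : R -> R | [/\ continuous f, forall y, 0 <= f y &
                        forall y, y <= x -> 1 <= f y]]].

Definition mean_cdf Phi x : R := inf (half_line_bounds Phi x).

(** Piecewise linear interpolation of [f] on the grid [x0 + i * d], [i <= n],
    extended by constants.  It is written with ramps because nothing but the means
    of ramps is controlled by a distribution function. *)
Fixpoint pl_interp f (x0 d : R) (n : nat) : R -> R :=
  if n is n'.+1 then
    fun y => (f (x0 + n'%:R * d) - f (x0 + n%:R * d)) * ramp (x0 + n'%:R * d) d y
             + (pl_interp f x0 d n' y - (f (x0 + n'%:R * d) - f (x0 + n%:R * d)))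
  else cst (f x0).

Lemma continuous_pl_interp f x0 d n : continuous (pl_interp f x0 d n).
Proof.
elim: n => [|n IH] /=; first exact: continuous_cst.
apply: continuous_lin; first exact: continuous_ramp.
by move=> y; apply: (@cvgB _ R^o); [exact: IH|exact: cvg_cst].
Qed.

(** On one step of the grid all ramps but one are constant, and the interpolant is
    a convex combination of the values of [f] at the two ends. *)
Lemma pl_interp_dist f x0 d (w : R) n : 0 < d -> 0 <= w ->
  (forall i y, (i < n)%N -> x0 + i%:R * d <= y <= x0 + i.+1%:R * d ->
     `|f y - f (x0 + i%:R * d)| <= w /\ `|f y - f (x0 + i.+1%:R * d)| <= w) ->
  (forall y, x0 + n%:R * d <= y -> pl_interp f x0 d n y = f (x0 + n%:R * d)) /\
  (forall y, x0 <= y <= x0 + n%:R * d -> `|f y - pl_interp f x0 d n y| <= w).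
Proof.
move=> d0 w0; elim: n => [|n IH] osc.
  split => y /=; first by rewrite mul0r addr0.
  by rewrite mul0r addr0 => /le_anti ->; rewrite subrr normr0.
have [IH1 IH2] := IH (fun i y lin => osc i y (leqW lin)).
have E : x0 + n.+1%:R * d = x0 + n%:R * d + d by rewrite -natr1 mulrDl mul1r addrA.
split => [y yx|y /andP[y0 yx]].
  rewrite /= ramp0// -?E// mulr0 add0r IH1; first by ring.
  by apply: le_trans yx; rewrite E lerDl ltW.
have [yn|ny] := leP y (x0 + n%:R * d).
  by rewrite /= ramp1// mulr1 [X in _ - X]addrC subrK IH2// y0.
rewrite /= IH1 ?(ltW ny)//.
have [h1 h2] := osc n y (leqnn _) (introT andP (conj (ltW ny) yx)).
have r0 := ramp_ge0 (x0 + n%:R * d) d y.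
have r1 := ramp_le1 (x0 + n%:R * d) d y.
set r := ramp _ _ _ in r0 r1 *.
move: h1 h2; set u := f (x0 + n%:R * d); set v := f (x0 + n.+1%:R * d).
rewrite !ler_norml => /andP[a1 a2] /andP[b1 b2].
by apply/andP; split; nra.
Qed.

(** For each ramp the two means differ by at most one increment of [F], and the
    increments telescope along the grid. *)
Lemma mean_pl_interp_dist C Phi Psi F f x0 d (w : R) n :
  mean_on C Phi -> mean_on C Psi -> 0 < d -> 0 <= w ->
  (forall x y, x <= y -> F x <= F y) ->
  (forall x, F x <= Phi (ramp x d) <= F (x + d)) ->
  (forall x, F x <= Psi (ramp x d) <= F (x + d)) ->
  (forall i, (i < n)%N -> `|f (x0 + i%:R * d) - f (x0 + i.+1%:R * d)| <= w) ->
  `|Phi (pl_interp f x0 d n) - Psi (pl_interp f x0 d n)| <=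
    w * (F (x0 + n%:R * d) - F x0).
Proof.
move=> mPhi mPsi d0 w0 ndF FPhi FPsi; elim: n => [|n IH] osc.
  by rewrite /= !(mean_cst mPhi) (mean_cst mPsi) mul0r addr0 !subrr normr0 mulr0.
have {}IH := IH (fun i lin => osc i (leqW lin)).
have E : x0 + n.+1%:R * d = x0 + n%:R * d + d by rewrite -natr1 mulrDl mul1r addrA.
have cc : continuous (fun y => pl_interp f x0 d n y -
    (f (x0 + n%:R * d) - f (x0 + n.+1%:R * d))).
  by move=> y; apply: (@cvgB _ R^o); [exact: continuous_pl_interp|exact: cvg_cst].
have step Xi : mean_on C Xi -> Xi (pl_interp f x0 d n.+1) =
    (f (x0 + n%:R * d) - f (x0 + n.+1%:R * d)) * Xi (ramp (x0 + n%:R * d) d) +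
    (Xi (pl_interp f x0 d n) - (f (x0 + n%:R * d) - f (x0 + n.+1%:R * d))).
  move=> mX; have [lin _ _] := mX.
  rewrite /= lin//; last exact: continuous_ramp.
  rewrite (meanD mX (@continuous_pl_interp _ _ _ _) (@continuous_cst _ _)).
  by rewrite (mean_cst mX).
rewrite !step//.
have := osc n (leqnn _); set u := f _ - f _ => hu.
have /andP[p1 p2] := FPhi (x0 + n%:R * d).
have /andP[s1 s2] := FPsi (x0 + n%:R * d).
move: p1 p2 s1 s2; rewrite -E; set p := Phi _; set s := Psi _ => p1 p2 s1 s2.
have -> : u * p + (Phi (pl_interp f x0 d n) - u) -
    (u * s + (Psi (pl_interp f x0 d n) - u)) =
  u * (p - s) + (Phi (pl_interp f x0 d n) - Psi (pl_interp f x0 d n)) by ring.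
apply: le_trans (ler_normD _ _) _.
have -> : w * (F (x0 + n.+1%:R * d) - F x0) =
  w * (F (x0 + n.+1%:R * d) - F (x0 + n%:R * d)) +
  w * (F (x0 + n%:R * d) - F x0) by ring.
apply: lerD => //; rewrite normrM; apply: ler_pM => //.
by rewrite ler_norml; apply/andP; split; lra.
Qed.

(** A mean is determined by any distribution function that its values on ramps
    follow: refine the grid of the interpolation. *)
Lemma mean_cdf_unique C Phi Psi F : 0 < C -> mean_on C Phi -> mean_on C Psi ->
  (forall x y, x <= y -> F x <= F y) -> (forall x, 0 <= F x <= 1) ->
  (forall x d, 0 < d -> F x <= Phi (ramp x d) <= F (x + d)) ->
  (forall x d, 0 < d -> F x <= Psi (ramp x d) <= F (x + d)) ->
  forall f, continuous f -> Phi f = Psi f.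
Proof.
move=> C0 mPhi mPsi ndF F01 FPhi FPsi f cf; apply/eqP; rewrite -subr_eq0 -normr_le0.
apply/ler_addgt0Pr => e e0; rewrite add0r.
have e6 : 0 < e / 6 by rewrite divr_gt0.
have [K K0 Kf] := continuous_quadratic_modulus cf (ltW C0) e6.
have [n nE n0] : exists2 n : nat,
    K * (2 * C) ^+ 2 / (e / 6) < n%:R & (0:R) < n%:R.
  exists (Num.truncn (K * (2 * C) ^+ 2 / (e / 6))).+1; first exact: truncnS_gt.
  by rewrite ltr0n.
pose d := 2 * C / n%:R.
have d0 : 0 < d by rewrite divr_gt0// mulr_gt0.
have nd : n%:R * d = 2 * C by rewrite /d mulrC divfK// gt_eqF.
have n1 : 1 <= n%:R :> R by rewrite ler1n; move: n0; rewrite ltr0n.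
have Kd : K * d ^+ 2 <= e / 6.
  rewrite /d expr_div_n mulrA ler_pdivrMr ?exprn_gt0//.
  move/ltW : nE; rewrite ler_pdivrMr// => /le_trans; apply.
  by rewrite mulrC ler_wpM2l ?(ltW e6)// expr2 ler_peMr// ltW.
have osc y z : `|y| <= C -> `|z| <= C -> `|y - z| <= d -> `|f y - f z| <= e / 3.
  move=> yC zC yz; apply: le_trans (Kf _ _ yC zC) _.
  have : K * (y - z) ^+ 2 <= K * d ^+ 2.
    by rewrite ler_wpM2l// -[leLHS]real_normK ?num_real// lerXn2r ?nnegrE ?(ltW d0).
  by lra.
have grid i : (i <= n)%N -> 0 <= i%:R * d <= 2 * C.
  move=> lin; rewrite mulr_ge0 ?(ltW d0)//= -nd ler_wpM2r ?(ltW d0)//.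
  by rewrite ler_nat.
have oscn i y : (i < n)%N -> - C + i%:R * d <= y <= - C + i.+1%:R * d ->
   `|f y - f (- C + i%:R * d)| <= e / 3 /\ `|f y - f (- C + i.+1%:R * d)| <= e / 3.
  move=> lin /andP[y1 y2].
  have /andP[i0 i1] := grid _ (ltnW lin); have /andP[j0 j1] := grid _ lin.
  have E : i.+1%:R * d = i%:R * d + d by rewrite -natr1 mulrDl mul1r.
  have [yC [iC [jC [yi yj]]]] : `|y| <= C /\ `|- C + i%:R * d| <= C /\
      `|- C + i.+1%:R * d| <= C /\ `|y - (- C + i%:R * d)| <= d /\
      `|y - (- C + i.+1%:R * d)| <= d.
    move: y1 y2 i0 i1 j0 j1; rewrite E !ler_norml.
    move: (i%:R * d) => u; clear -C; move=> *.
    by do !split; apply/andP; split; lra.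
  by split; apply: osc.
have e3 : 0 <= e / 3 by rewrite divr_ge0// ltW.
have [_ gf] := pl_interp_dist d0 e3 oscn.
have gd x : `|x| <= C -> `|f x - pl_interp f (- C) d n x| <= e / 3.
  by rewrite ler_norml => /andP[x1 x2]; apply: gf; apply/andP; split; lra.
have := mean_dist mPhi cf (@continuous_pl_interp _ _ _ _) gd.
have := mean_dist mPsi cf (@continuous_pl_interp _ _ _ _) gd.
have : `|Phi (pl_interp f (- C) d n) - Psi (pl_interp f (- C) d n)| <= e / 3.
  apply: le_trans (mean_pl_interp_dist mPhi mPsi d0 e3 ndF _ _ _) _.
  - by move=> x; exact: FPhi.
  - by move=> x; exact: FPsi.
  - move=> i lin; apply: (oscn i _ lin _).2; rewrite lexx/=.
    by rewrite lerD2l ler_wpM2r ?(ltW d0)// ler_nat.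
  - have /andP[? ?] := F01 (- C + n%:R * d); have /andP[? ?] := F01 (- C).
    by rewrite ler_piMr//; lra.
rewrite !ler_norml => /andP[? ?] /andP[? ?] /andP[? ?].
by apply/andP; split; lra.
Qed.

Section cdf.
Variables (C : R) (Phi : (R -> R) -> R).
Hypothesis mPhi : mean_on C Phi.

Let A := half_line_bounds Phi.

Let A_ge0 x : lbound (A x) 0.
Proof. by move=> _ [f [cf f0 _] <-]; have [_ _] := mPhi; apply. Qed.

Let A1 x : A x 1.
Proof.
exists (cst 1); first by split => //; exact: continuous_cst.
by have [_ ] := mPhi.
Qed.

Let cdf_le x f : continuous f -> (forall y, 0 <= f y) ->
  (forall y, y <= x -> 1 <= f y) -> mean_cdf Phi x <= Phi f.
Proof. by move=> cf f0 f1; apply: ge_inf; [exists 0; exact: A_ge0|exists f]. Qed.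

Let le_cdf x (c : R) : (forall f, continuous f -> (forall y, 0 <= f y) ->
  (forall y, y <= x -> 1 <= f y) -> c <= Phi f) -> c <= mean_cdf Phi x.
Proof.
move=> h; apply: lb_le_inf; first by exists 1; exact: A1.
by move=> _ [f [cf f0 f1] <-]; exact: h.
Qed.

Lemma mean_cdf_ge0_le1 x : 0 <= mean_cdf Phi x <= 1.
Proof.
apply/andP; split; first by apply: le_cdf => f cf f0 _; have [_ _] := mPhi; apply.
have [_ <- _] := mPhi; apply: cdf_le => //; exact: continuous_cst.
Qed.

Lemma mean_cdf_nd x y : x <= y -> mean_cdf Phi x <= mean_cdf Phi y.
Proof.
move=> xy; apply: le_cdf => f cf f0 f1; apply: cdf_le => // z zx; apply: f1.
exact: le_trans xy.
Qed.

Lemma mean_cdf_ramp x d : 0 < d ->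
  mean_cdf Phi x <= Phi (ramp x d) <= mean_cdf Phi (x + d).
Proof.
move=> d0; apply/andP; split.
  apply: cdf_le; [exact: continuous_ramp|exact: ramp_ge0|].
  by move=> y yx; rewrite ramp1.
apply: le_cdf => f cf f0 f1; apply: (mean_le mPhi) => //.
  exact: continuous_ramp.
move=> y _; have [yx|xy] := leP y (x + d).
  by rewrite (le_trans (ramp_le1 _ _ _))// f1.
by rewrite ramp0// ltW.
Qed.

(** If [f] is nearly optimal at [x], then [(1 + h) * f] is still at least [1]
    slightly to the right of [x], and its mean is not much larger. *)
Lemma mean_cdf_right_continuous : right_continuous (mean_cdf Phi).
Proof.
move=> x; apply/cvgrPdist_le => e e0.
have e2 : 0 < e / 2 by rewrite divr_gt0.
have [||_ [f [cf f0 f1] <-] fe] := @inf_adherent _ (A x) (e / 2) => //.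
  by split; [exists 1; exact: A1|exists 0; exact: A_ge0].
have Phif : 0 <= Phi f by have [_ _] := mPhi; apply.
pose h := e / 2 / (Phi f + 1).
have Phif1 : 0 < Phi f + 1 by lra.
have h0 : 0 < h by rewrite divr_gt0.
have hPhi : h * Phi f <= e / 2.
  by rewrite /h mulrAC ler_pdivrMr// ler_wpM2l ?(ltW e2)//; lra.
have h1 : 0 < 1 + h by lra.
have hh : 0 < h / (1 + h) by rewrite divr_gt0.
have /(@cvgrPdist_lt _ R^o _ _ (nbhs_filter x)) /(_ _ hh) [r /= r0 rP] := cf x.
near=> t; have xt : x < t by near: t; exact: nbhs_right_gt.
have tr : t < x + r by near: t; apply: nbhs_right_lt; rewrite ltrDl.
have Ft : mean_cdf Phi t <= (1 + h) * Phi f.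
  rewrite -(meanZ mPhi)//; apply: cdf_le.
  - by move=> y; apply: cvgM; [exact: cvg_cst|exact: cf].
  - by move=> y; rewrite mulr_ge0// ltW.
  - move=> y yt; have [yx|xy] := leP y x.
      by have := f1 _ yx; nra.
    have /rP : `|x - y| < r by rewrite ltr_norml; apply/andP; split; lra.
    move=> /= fxy; have := f1 _ (lexx x).
    have : h / (1 + h) = 1 - (1 + h)^-1 by field; rewrite gt_eqF.
    have h1' : (1 + h) * (1 + h)^-1 = 1 by rewrite divff// gt_eqF.
    move: fxy; rewrite ltr_norml => /andP[? ?] ? ?.
    by rewrite -[leLHS]h1' ler_pM2l//; lra.
have := mean_cdf_nd (ltW xt).
rewrite ler_norml => ?; apply/andP; split; lra.
Unshelve. all: by end_near. Qed.

Lemma mean_cdf_Ny x : x < - C -> mean_cdf Phi x = 0.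
Proof.
move=> xC; have d0 : 0 < - C - x by rewrite subr_gt0.
apply/le_anti/andP; split; last by have /andP[] := mean_cdf_ge0_le1 x.
have /andP[h _] := mean_cdf_ramp x d0; apply: (le_trans h).
rewrite -(mean0 mPhi).
apply: (mean_le mPhi); [exact: continuous_ramp|exact: continuous_cst|].
by move=> y; rewrite ler_norml => /andP[yC _]; rewrite ramp0//; lra.
Qed.

Lemma mean_cdf_y x : C <= x -> mean_cdf Phi x = 1.
Proof.
move=> Cx; apply/le_anti/andP; split; first by have /andP[] := mean_cdf_ge0_le1 x.
apply: le_cdf => f cf f0 f1; have [_ <- _] := mPhi.
apply: (mean_le mPhi) => //; first exact: continuous_cst.
by move=> y; rewrite ler_norml => /andP[_ yC]; apply: f1; exact: le_trans Cx.
Qed.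

End cdf.

Section riesz_measure.
Variables (C : R) (Phi : (R -> R) -> R).
Hypotheses (C0 : 0 <= C) (mPhi : mean_on C Phi).

Let F := mean_cdf Phi.

Let F_nd : nondecreasing F.
Proof. by move=> x y; exact: (mean_cdf_nd mPhi). Qed.

Let F_rc : right_continuous F.
Proof. exact: (mean_cdf_right_continuous mPhi). Qed.

#[local] HB.instance Definition _ := isCumulative.Build R _ R F F_nd F_rc.

Let F_Ny : F @ -oo --> (0:R).
Proof.
apply: cvg_near_cst; near=> x; apply: (mean_cdf_Ny mPhi).
by near: x; apply: nbhs_ninfty_lt; rewrite num_real.
Unshelve. all: by end_near. Qed.

Let F_y : F @ +oo --> (1:R).
Proof.
apply: cvg_near_cst; near=> x; apply: (mean_cdf_y mPhi).
by near: x; apply: nbhs_pinfty_ge; rewrite num_real.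
Unshelve. all: by end_near. Qed.

#[local] HB.instance Definition _ := isCumulativeBounded.Build R 0 1 F F_Ny F_y.

Let ls := lebesgue_stieltjes_measure F.

(* [ls] lives on the sigma-algebra generated by the half-open intervals; its image
   under the identity is a measure on the Borel sets of [R]. *)
Let idTR : measurableTypeR R -> R := idfun.

#[local] HB.instance Definition _ :=
  @isMeasurableFun.Build _ _ _ _ idTR (@measurable_id _ _ setT).

Let P : probability R R := distribution ls (idTR : {RV ls >-> R}).

Let PE x : P `]-oo, x]%classic = (F x)%:E.
Proof. exact: (cdf_lebesgue_stieltjes_id F x). Qed.

(** The Lebesgue-Stieltjes measure of [mean_cdf Phi] follows the same values on
    ramps as [Phi].  The interval grows by [1] because [Phi] may charge the point
    [- C], where [mean_cdf Phi] is then positive. *)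
Lemma riesz : exists2 muS : {finite_measure set R -> \bar R},
   muS setT = 1%E /\ muS (~` `[- (C + 1), C + 1]) = 0%E &
   forall f, continuous f -> (\int[muS]_x (f x)%:E = (Phi f)%:E)%E.
Proof.
pose muS : {finite_measure set R -> \bar R} := P.
have muS1 : muS setT = 1%E := probability_setT P.
have muSE x : muS `]-oo, x]%classic = (F x)%:E := PE x.
have Cp : C < C + 1 by rewrite ltrDl.
have C1 : 0 < C + 1 by exact: le_lt_trans Cp.
have muS0' : muS (~` `[- (C + 1), C + 1]) = 0%E.
  have sub : ~` `[- (C + 1), C + 1]%classic `<=`
      `]-oo, - (C + 1)]%classic `|` ~` `]-oo, C + 1]%classic.
    move=> x /=; rewrite !in_itv/= => /negP.
    rewrite negb_and -!ltNge => /orP[h|h].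
      by left; rewrite ltW.
    by right; apply/negP; rewrite -ltNge.
  have mI (i : interval R) : measurable [set` i] by exact: measurable_itv.
  have c1 : muS `]-oo, - (C + 1)]%classic = 0%E.
    by rewrite muSE /F (mean_cdf_Ny mPhi) ?ltrN2.
  have c2 : muS (~` `]-oo, C + 1]%classic) = 0%E.
    rewrite (_ : muS _ = 1 - P `]-oo, (C + 1)%R]%classic)%E; last first.
      exact: probability_setC.
    by rewrite PE /F (mean_cdf_y mPhi) ?(ltW Cp)// subee.
  apply: (subset_measure0 _ _ sub); first exact: measurableC.
    by apply: measurableU => //; exact: measurableC.
  by apply: null_set_setU => //; exact: measurableC.
exists muS => // f cf.
have muSlt : (muS setT < +oo)%E by rewrite muS1 ltry.
have mS := mean_on_integral (ltW C1) muS1 muS0'.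
have intf g : continuous g -> muS.-integrable setT (fun x => (g x)%:E).
  by move=> cg; apply: (integrable_continuous muSlt (ltW C1)).
have mP : mean_on (C + 1) Phi := mean_onW mPhi (ltW Cp).
rewrite -(mean_cdf_unique C1 mS mP F_nd (mean_cdf_ge0_le1 mPhi) _ _ cf) /=.
- by rewrite /Rintegral fineK//; apply: integrable_fin_num => //; exact: intf.
- move=> x d d0.
  have rampE : (\int[muS]_x0 (ramp x d x0)%:E = (\int[muS]_x0 ramp x d x0)%R%:E)%E.
    rewrite /Rintegral fineK//; apply: integrable_fin_num => //; apply: intf.
    exact: continuous_ramp.
  have mramp : measurable_fun setT (EFin \o ramp x d).
    apply/measurable_EFinP; apply: continuous_measurable_fun.
    exact: continuous_ramp.
  have mI (y : R) :
      measurable_fun setT (fun z => (\1_(`]-oo, y]%classic : set R) z)%:E : \bar R).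
    by apply/measurable_EFinP; exact: measurable_indic.
  have indE y : (\int[muS]_z (\1_(`]-oo, y]%classic : set R) z)%:E = (F y)%:E)%E.
    by rewrite integral_indic// setIT; exact: PE.
  apply/andP; split; rewrite -lee_fin -rampE -indE; apply: ge0_le_integral => //.
  + move=> z _; rewrite lee_fin indicE mem_setE.
    case: (boolP (_ \in _)) => [|_]; last exact: ramp_ge0.
    by rewrite in_itv/= => zx; rewrite ramp1.
  + by move=> z _; rewrite lee_fin ramp_ge0.
  + move=> z _; rewrite lee_fin indicE; have [zx|xz] := leP z (x + d).
      by rewrite mem_set//= ?ramp_le1// in_itv.
    by rewrite ramp0// ltW.
- by move=> x d d0; exact: (mean_cdf_ramp mPhi).
Qed.

End riesz_measure.

End riesz.

(** * Finite measures carried by an interval *)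
Section tame.
Context {R : realType}.
Implicit Types (f g : R -> R) (C : R) (mu nu : {measure set R -> \bar R}).

(** The property that makes all continuous functions integrable and that passes to
    multiples, sums and continuous densities; every measure below has it. *)
Definition tame C nu := (nu setT < +oo)%E /\ nu (~` `[- C, C]) = 0%E.

Lemma measurable_outside C : measurable (~` `[- C, C]%classic : set R).
Proof. by apply: measurableC; exact: measurable_itv. Qed.

Lemma tame_integrable C nu f : 0 <= C -> tame C nu -> continuous f ->
  nu.-integrable setT (fun x => (f x)%:E).
Proof. by move=> C0 [nuT nuC]; exact: integrable_continuous nuT C0 nuC. Qed.

Lemma tame_integralE C nu f : 0 <= C -> tame C nu -> continuous f ->
  (\int[nu]_x (f x)%:E)%E = (\int[nu]_x f x)%:E.
Proof.
move=> C0 tnu cf; rewrite /Rintegral fineK//; apply: integrable_fin_num => //.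
exact: tame_integrable tnu cf.
Qed.

Lemma tame_mscale C nu (w : {nonneg R}) : tame C nu -> tame C (mscale w nu).
Proof.
move=> [nuT nuC]; split; rewrite /= /mscale; last by rewrite nuC mule0.
by apply: lte_mul_pinfty => //; rewrite lee_fin.
Qed.

Lemma tame_msum C (nu : nat -> {measure set R -> \bar R}) n :
  (forall k, (k < n)%N -> tame C (nu k)) -> tame C (msum nu n).
Proof.
move=> tnu; split; rewrite /= /msum.
  by apply/lte_sum_pinfty => k _; exact: (tnu k (ltn_ord k)).1.
by rewrite big1// => k _; exact: (tnu k (ltn_ord k)).2.
Qed.

Lemma tame_mdensity C mu (f : R -> R) (f0 : forall x, 0 <= f x)
    (mf : measurable_fun setT f) : 0 <= C -> tame C mu -> continuous f ->
  tame C (mdensity mu f0 mf).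
Proof.
move=> C0 tmu cf; split; rewrite /= /mdensity.
  by rewrite (tame_integralE C0 tmu cf) ltry.
apply: null_set_integral; [exact: measurable_outside| |exact: tmu.2].
by apply/measurable_funTS/measurable_EFinP.
Qed.

Lemma tame_dirac C (x : R) : `|x| <= C -> tame C (dirac x).
Proof.
move=> xC; split; first by rewrite /= diracE mem_setT ltry.
rewrite /= diracE memNset//= in_itv/= -ler_norml xC; exact.
Qed.

Lemma integral_ge0_eq0 mu f : continuous f -> (forall x, 0 <= f x) ->
  (\int[mu]_x (f x)%:E = 0)%E -> mu [set x | f x != 0] = 0%E.
Proof.
move=> cf f0 If.
have mf : measurable_fun setT (EFin \o f).
  by apply/measurable_EFinP; exact: continuous_measurable_fun.
have : (\int[mu]_x `|(EFin \o f) x| = 0)%E.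
  by under eq_integral do rewrite gee0_abs ?lee_fin//.
move/(ae_eq_integral_abs mu measurableT mf) => [A [mA A0 subA]].
have mS : measurable [set x | f x != 0].
  have -> : [set x | f x != 0] = f @^-1` (~` [set 0]).
    by apply/seteqP; split=> x /= /eqP.
  rewrite -[X in measurable X]setTI.
  by apply: (continuous_measurable_fun cf) => //; exact: measurableC.
apply: (subset_measure0 mS mA _ A0) => x /= fx; apply: subA => /=.
by move=> /(_ Logic.I) [] /eqP; rewrite (negPf fx).
Qed.

End tame.

Section tame_integrals.
Context {R : realType}.
Implicit Types (f : R -> R) (C : R) (nu : {measure set R -> \bar R}).

Lemma tame_integral_mscale C nu (w : {nonneg R}) f : 0 <= C -> tame C nu ->
  continuous f -> \int[mscale w nu]_x f x = w%:num * \int[nu]_x f x.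
Proof.
move=> C0 tnu cf; rewrite {1}/Rintegral.
rewrite (eq_measure_integral (msum (fun=> mscale w nu) 1)); last first.
  by move=> A mA _; rewrite /= /msum big_ord_recl big_ord0 adde0.
rewrite (@integral_mscale_msum _ (fun=> nu) (fun=> w)) /=.
  by rewrite big_ord_recl big_ord0 addr0.
by move=> _ _; exact: (tame_integrable C0 tnu cf).
Qed.

Lemma tame_integral_msum C (nu : nat -> {measure set R -> \bar R}) n f :
  0 <= C -> (forall k, (k < n)%N -> tame C (nu k)) -> continuous f ->
  \int[msum nu n]_x f x = \sum_(k < n) \int[nu k]_x f x.
Proof.
move=> C0 tnu cf; rewrite {1}/Rintegral.
rewrite (eq_measure_integral (msum (fun k => mscale 1%:nng (nu k)) n)); last first.
  move=> A mA _; rewrite /= /msum; apply: eq_bigr => k _.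
  by rewrite /mscale -[LHS]mul1e; congr (_ * _)%E.
rewrite (@integral_mscale_msum _ nu (fun=> 1%:nng)) /=.
  by apply: eq_bigr => k _; rewrite mul1r.
by move=> k kn; exact: (tame_integrable C0 (tnu k kn) cf).
Qed.

(** Weak convergence speaks of bounded functions only.  Composition with the
    projection onto [[-C, C]] makes a continuous function bounded and does not
    affect its integral against a measure carried by [[-C, C]]. *)
Lemma continuous_clamp f C : continuous f ->
  continuous (fun x => f (Num.max (- C) (Num.min C x))).
Proof.
move=> cf x; apply: continuous_comp; last exact: cf.
apply: (@continuous_max _ _ (cst (- C)) (fun z => Num.min C z)).
  exact: cvg_cst.
by apply: (@continuous_min _ _ (cst C) id); [exact: cvg_cst|exact: cvg_id].
Qed.

Lemma clamp_id C (x : R) : `|x| <= C -> Num.max (- C) (Num.min C x) = x.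
Proof. by rewrite ler_norml => /andP[x1 x2]; rewrite min_r// max_r. Qed.

Lemma clamp_norm C (x : R) : 0 <= C -> `|Num.max (- C) (Num.min C x)| <= C.
Proof.
move=> C0; rewrite ler_norml le_max lexx/= ge_max ge_min lexx/= andbT.
by rewrite (le_trans _ C0)// lerNl oppr0.
Qed.

Lemma clamp_bounded f C : continuous f -> 0 <= C ->
  exists M : R, forall x, `|f (Num.max (- C) (Num.min C x))| <= M.
Proof.
move=> cf C0; have [M fM] := continuous_bounded_itv cf C0.
by exists M => x; apply: fM; exact: clamp_norm.
Qed.

(** A nonnegative function that vanishes exactly on [[-C, C]] has integral zero
    against all [m n], hence against the limit. *)
Lemma weak_limit_tame C (m : nat -> {measure set R -> \bar R})
    (muS : {finite_measure set R -> \bar R}) : 0 <= C ->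
  (forall n, tame C (m n)) -> (forall n, m n setT = 1%E) -> weak_cvg m muS ->
  muS setT = 1%E /\ tame C muS.
Proof.
move=> C0 tm m1 wm.
have S1 : muS setT = 1%E.
  have b1 : exists B : R, forall x, `|(cst 1 : R -> R) x| <= B.
    by exists 1 => x; rewrite /= normr1.
  have := wm (cst 1) (@continuous_cst _ 1) b1.
  have int1 (nu : {measure set R -> \bar R}) :
      (\int[nu]_x ((cst 1 : R -> R) x)%:E = nu setT)%E.
    by rewrite -[RHS]mul1e -integral_cst.
  have -> : (fun n => \int[m n]_x ((cst 1 : R -> R) x)%:E)%E = cst 1%E.
    by apply/funext => n; rewrite int1 m1.
  by rewrite int1 => h; apply: (cvg_unique _ h) => //; exact: cvg_cst.
have S1lt : (muS setT < +oo)%E by rewrite S1 ltry.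
split => //; split; first exact: S1lt.
pose h (x : R) : R := Num.min 1 (Num.max 0 (`|x| - C)).
have ch : continuous h.
  move=> x.
  apply: (@continuous_min _ _ (cst 1) (fun z => Num.max 0 (`|z| - C))).
    exact: cvg_cst.
  apply: (@continuous_max _ _ (cst 0) (fun z => `|z| - C)).
    exact: cvg_cst.
  apply: (@cvgB _ R^o); last exact: cvg_cst.
  by apply: cvg_norm; exact: cvg_id.
have h0 x : 0 <= h x by rewrite /h le_min ler01 le_max lexx.
have h1 x : `|h x| <= 1 by rewrite ger0_norm// /h ge_min lexx.
have hC x : `|x| <= C -> h x = cst 0 x.
  by move=> xC; rewrite /h max_l ?min_r// subr_le0.
have mh n : (\int[m n]_x (h x)%:E = 0)%E.
  rewrite (tame_integralE C0 (tm n) ch).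
  have mm := mean_on_integral C0 (m1 n) (tm n).2.
  by rewrite (mean_eq mm ch (@continuous_cst _ 0) hC) (mean0 mm).
have Sh : (\int[muS]_x (h x)%:E = 0)%E.
  have := wm h ch (ex_intro _ 1 h1).
  have -> : (fun n => \int[m n]_x (h x)%:E)%E = cst 0%E by apply/funext.
  by move=> hh; apply: (cvg_unique _ hh) => //; exact: cvg_cst.
have mA := @measurable_outside R C.
apply: (subset_measure0 mA _ _ (integral_ge0_eq0 ch h0 Sh)).
  have -> : [set x | h x != 0] = h @^-1` (~` [set 0]).
    by apply/seteqP; split=> x /= /eqP.
  rewrite -[X in measurable X]setTI.
  by apply: (continuous_measurable_fun ch) => //; exact: measurableC.
move=> x; rewrite /= in_itv/= -ler_norml => /negP; rewrite -ltNge => Cx.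
by rewrite gt_eqF// /h lt_min ltr01 lt_max subr_gt0 Cx orbT.
Qed.

End tame_integrals.

(** * Orthonormal polynomials of one measure *)
Section orthonormal.
Context {R : realType}.
Variable (mu : {finite_measure set R -> \bar R}).
Variables (p : nat -> {poly R}) (a b : nat -> R).
Hypothesis mu_bounded : on_bounded_interval mu.
Hypothesis mu_infinite : infinite_set (msupport mu).
Hypothesis p_orthonormal : orthonormal_polys mu p.
Hypothesis ab_coefs : recurrence_coefs p a b.
Implicit Types q r : {poly R}.

Let p_size l : size (p l) = l.+1.
Proof. by case: p_orthonormal. Qed.

Lemma bounded_tame : exists2 C, 0 <= C & tame C mu.
Proof.
case: mu_bounded => c [d mucd]; exists (Num.max `|c| `|d|).
  by rewrite le_max normr_ge0.
split; first by rewrite ltey_eq fin_num_measure.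
apply: (subset_measure0 (measurable_outside _) _ _ mucd).
  by apply: measurableC; exact: measurable_itv.
move=> x /= h; contradict h; move: h; rewrite !in_itv/= => /andP[cx xd].
rewrite -ler_norml le_max; case: (lerP 0 x) => x0.
  by apply/orP; right; rewrite (ger0_norm x0) (le_trans xd)// ler_norm.
apply/orP; left; rewrite -normrN [leRHS](_ : _ = `|- c|) ?normrN//.
by rewrite !ler0_norm ?lerN2// ltW// (le_lt_trans cx).
Qed.

Lemma integrable_horner q : mu.-integrable setT (fun x => (q.[x])%:E).
Proof.
have [C C0 tC] := bounded_tame; apply: tame_integrable tC _ => //.
exact: continuous_horner.
Qed.

Let I q : R := \int[mu]_x q.[x].

Let ID q r : I (q + r) = I q + I r.
Proof.
rewrite /I -RintegralD//; [|exact: integrable_horner..].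
by apply: eq_Rintegral => x _; rewrite hornerD.
Qed.

Let IZ c q : I (c *: q) = c * I q.
Proof.
rewrite /I -RintegralZl//; last exact: integrable_horner.
by apply: eq_Rintegral => x _; rewrite hornerZ.
Qed.

Let Iortho l m : I (p l * p m) = (l == m)%:R.
Proof.
have [_ _ /(_ l m) h] := p_orthonormal; rewrite /I /Rintegral.
by under eq_integral do rewrite hornerM; rewrite h.
Qed.

Let I0 : I 0 = 0.
Proof. by rewrite -(scale0r (0 : {poly R})) IZ mul0r. Qed.

Let Isum n (c : 'I_n -> R) (q : 'I_n -> {poly R}) :
  I (\sum_(i < n) c i *: q i) = \sum_(i < n) c i * I (q i).
Proof.
elim: n c q => [|n IH] c q; first by rewrite !big_ord0 I0.
by rewrite !big_ord_recr /= ID IZ IH.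
Qed.

Lemma orthonormal_polys_free n (u : 'I_n -> R) : \sum_(l < n) u l *: p l = 0 ->
  forall i, u i = 0.
Proof.
move=> h i; have : I ((\sum_(l < n) u l *: p l) * p i) = u i.
  rewrite mulr_suml; under eq_bigr do rewrite -scalerAl.
  rewrite Isum (bigD1 i)//= Iortho eqxx mulr1 big1 ?addr0// => l li.
  by rewrite Iortho (_ : (l == i :> nat) = false) ?mulr0//; exact: negbTE.
by rewrite h mul0r I0.
Qed.

(** A nonnegative polynomial of integral zero vanishes on the support, which is
    infinite. *)
Lemma integral_poly_eq0 q : (forall x, 0 <= q.[x]) -> \int[mu]_x q.[x] = 0 ->
  q = 0.
Proof.
move=> q0 Iq; apply: contrapT => /eqP qn0.
have [C C0 tC] := bounded_tame.
have IqE : (\int[mu]_x (q.[x])%:E = 0)%E.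
  by rewrite (tame_integralE C0 tC (@continuous_horner _ q)) Iq.
have := integral_ge0_eq0 (@continuous_horner _ q) q0 IqE.
set U := [set x | _] => muU; apply: mu_infinite.
have oU : open U.
  have -> : U = horner q @^-1` (~` [set 0]).
    by apply/seteqP; split=> x /= /eqP.
  apply: open_comp; first by move=> x _; exact: continuous_horner.
  rewrite openC; apply: accessible_closed_set1; apply: hausdorff_accessible.
  exact: Rhausdorff.
apply: (@sub_finite_set _ _ [set` rootsR q]); last exact: finite_seq.
move=> x sx /=; rewrite -[_ \in _](roots_on_rootsR qn0) in_itv/=; apply/rootP.
apply: contrapT => /eqP qx; have := sx U (conj oU qx).
by rewrite muU ltxx.
Qed.

(** A polynomial of size [k.+1] becomes smaller when the right multiple of [p k]
    is subtracted, so the [p k] with [k < n] span what is needed. *)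
Lemma orthogonal_lower n q : (size q <= n)%N -> \int[mu]_x (p n * q).[x] = 0.
Proof.
suff H k : (k <= n)%N -> forall q, (size q <= k)%N -> I (p n * q) = 0.
  by move=> qn; exact: (H n).
elim: k => [|k IH] kn {}q.
  by rewrite leqn0 size_poly_eq0 => /eqP ->; rewrite mulr0 I0.
move=> qk; pose c := q`_k / (p k)`_k.
have pk0 : (p k)`_k != 0.
  rewrite -[X in (p k)`_X]/(k.+1.-1) -p_size -/(lead_coef _) lead_coef_eq0.
  by rewrite -size_poly_eq0 p_size.
have -> : p n * q = p n * (q - c *: p k) + c *: (p n * p k).
  by rewrite scalerAr -mulrDr subrK.
rewrite ID IZ Iortho IH ?(ltnW kn)// ?add0r.
  by rewrite gtn_eqF// mulr0.
apply/leq_sizeP => j; rewrite leq_eqVlt => /predU1P[<-|kj].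
  by rewrite coefB coefZ divfK// subrr.
rewrite coefB coefZ !nth_default ?mulr0 ?subrr ?p_size//.
exact: leq_trans qk kj.
Qed.

(** Divide [p n] by the product [r] of the factors ['X - x] over its real roots.  If
    the quotient [g] is not constant, either it has a real root, which is then a
    double root of [p n], or it keeps a constant sign.  In both cases some
    polynomial of size at most [n] times [p n] is of one sign and not zero, although
    its integral vanishes by orthogonality. *)
Lemma size_rootsR_op n : size (rootsR (p n)) = n.
Proof.
have pn0 : p n != 0 by rewrite -size_poly_eq0 p_size.
set rs := rootsR (p n); pose r := \prod_(x <- rs) ('X - x%:P).
have mem x : (x \in rs) = root (p n) x by rewrite -roots_on_rootsR.
have urs : uniq rs.
  by apply: (sorted_uniq lt_trans (@ltxx _ _)); exact: sorted_roots.
have rp : r %| p n.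
  apply: uniq_roots_dvdp; last by rewrite uniq_rootsE.
  by apply/allP => x; rewrite mem.
have pE : p n = (p n %/ r) * r by rewrite divpK.
set g := p n %/ r in pE.
have /norP[g0 r0] : ~~ ((g == 0) || (r == 0)) by rewrite -mulf_eq0 -pE.
have rsz : size r = (size rs).+1 by rewrite size_prod_XsubC.
have psz : n.+1 = (size g + size rs)%N by rewrite -p_size pE size_mul// rsz addnS.
have [g1|g1] := eqVneq (size g) 1%N; first by move: psz; rewrite g1 add1n => -[].
have g2 : (1 < size g)%N by rewrite ltn_neqAle eq_sym g1 size_poly_gt0.
have [[c gc]|nog] := pselect (exists c, root g c).
  have /factor_theorem [g' gE] := gc.
  have : root r c by rewrite root_prod_XsubC mem pE rootM gc.
  move=> /factor_theorem [r' rE].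
  pose q := g' * r'.
  have pE' : p n = q * ('X - c%:P) ^+ 2 by rewrite pE gE rE /q; ring.
  have q0 : q != 0 by apply: contra_neq pn0 => q0; rewrite pE' q0 mul0r.
  have qn : (size q <= n)%N.
    have := p_size n; rewrite pE' size_Mmonic ?monic_exp ?monicXsubC//.
    by rewrite size_exp_XsubC addn3 /= => -[<-].
  have := orthogonal_lower qn; rewrite [p n in LHS]pE'.
  have -> : q * ('X - c%:P) ^+ 2 * q = (('X - c%:P) * q) ^+ 2 by ring.
  move=> Iq; have := integral_poly_eq0 _ Iq.
  have sq0 x : 0 <= ((('X - c%:P) * q) ^+ 2).[x] by rewrite horner_exp sqr_ge0.
  by move=> /(_ sq0) /eqP; rewrite expf_eq0/= mulf_eq0 polyXsubC_eq0 (negPf q0).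
have sg x : 0 <= g.[0] * g.[x].
  rewrite leNgt; apply/negP => gx; apply: nog.
  have [x0|x0] := leP 0 x.
    by have [c _ gc] := poly_ivtoo x0 gx; exists c.
  by rewrite mulrC in gx; have [c _ gc] := poly_ivtoo (ltW x0) gx; exists c.
have g00 : g.[0] != 0 by apply/negP => /eqP h; apply: nog; exists 0; apply/rootP.
have rn : (size r <= n)%N by rewrite rsz; lia.
have := orthogonal_lower rn; rewrite [p n in LHS]pE => Igr.
have : g.[0] *: (g * r * r) = 0.
  apply: integral_poly_eq0; last by rewrite -/(I _) IZ /I Igr mulr0.
  move=> x; have -> : (g.[0] *: (g * r * r)).[x] = g.[0] * g.[x] * r.[x] ^+ 2.
    by rewrite hornerZ !hornerM; ring.
  by rewrite mulr_ge0 ?sg ?sqr_ge0.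
by move/eqP; rewrite scaler_eq0 !mulf_eq0 (negPf g00) (negPf g0) (negPf r0).
Qed.

Lemma mem_rootsR_op n x : (x \in rootsR (p n)) = root (p n) x.
Proof. by rewrite -roots_on_rootsR// -size_poly_eq0 p_size. Qed.

Lemma uniq_rootsR_op n : uniq (rootsR (p n)).
Proof. by apply: (sorted_uniq lt_trans (@ltxx _ _)); exact: sorted_roots. Qed.

(** The entry [(k, l)] of the [m]-th power of the infinite Jacobi matrix. *)
Definition jacobi_moment m k l : R := \int[mu]_x (x ^+ m * (p k).[x] * (p l).[x]).

Let jmE m k l : jacobi_moment m k l = I ('X^m * p k * p l).
Proof. by apply: eq_Rintegral => x _; rewrite !hornerM hornerXn. Qed.

Lemma jacobi_moment0 k l : jacobi_moment 0 k l = (k == l)%:R.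
Proof. by rewrite jmE mul1r Iortho. Qed.

Lemma jacobi_momentS m k l : jacobi_moment m.+1 k l =
  b l.+1 * jacobi_moment m k l.+1 + a l * jacobi_moment m k l +
  b l * (if l is l'.+1 then jacobi_moment m k l' else 0).
Proof.
have [_ _ rec] := ab_coefs.
have -> : (if l is l'.+1 then jacobi_moment m k l' else 0) =
   I ('X^m * p k * (if l is l'.+1 then p l' else 0)).
  by case: l => [|l]; rewrite ?mulr0 ?I0 ?jmE.
rewrite !jmE -!IZ -!ID; apply: eq_Rintegral => x _.
have -> : ('X^(m.+1) * p k * p l).[x] = ('X^m * p k).[x] * (x * (p l).[x]).
  by rewrite exprSr !hornerM hornerX; ring.
rewrite rec !hornerD !hornerZ !hornerM; case: l => [|l]; rewrite ?horner0; ring.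
Qed.

Section bounded_coefs.
Variable M : R.
Hypotheses (aM : forall l, `|a l| <= M) (bM : forall l, `|b l| <= M).

Let M0 : 0 <= M. Proof. exact: le_trans (aM 0). Qed.

(** The rows of the Jacobi matrix have at most three entries, all bounded by [M]. *)
Lemma norm_jacobi_moment m k l : `|jacobi_moment m k l| <= (3 * M) ^+ m.
Proof.
elim: m l => [|m IH] l.
  by rewrite jacobi_moment0 expr0; case: eqP => _; rewrite ?normr1 ?normr0.
rewrite jacobi_momentS; apply: le_trans (ler_normD _ _) _.
have B u v : `|u| <= M -> `|v| <= (3 * M) ^+ m -> `|u * v| <= M * (3 * M) ^+ m.
  by move=> uM vM; rewrite normrM ler_pM.
have -> : (3 * M) ^+ m.+1 = M * (3 * M) ^+ m + M * (3 * M) ^+ m + M * (3 * M) ^+ m.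
  by rewrite exprS; ring.
apply: lerD; last first.
  apply: B => //; case: l => [|l] //.
  by rewrite normr0 exprn_ge0// mulr_ge0.
by apply: le_trans (ler_normD _ _) _; apply: lerD; apply: B.
Qed.

(** The even moments grow at most like the powers of [(3 * M) ^+ 2], whereas mass
    outside [[-C, C]] would make them grow at least like the powers of [C ^+ 2]. *)
Lemma tame_of_bounded_coefs : tame (3 * M + 1) mu.
Proof.
set C := 3 * M + 1; have C0 : 0 < C by rewrite /C; have := M0; lra.
split; first by rewrite ltey_eq fin_num_measure.
set A := ~` _; have mA : measurable A := @measurable_outside R C.
have pc : p 0 = (lead_coef (p 0))%:P.
  have /size1_polyC -> : (size (p 0) <= 1)%N by rewrite p_size.
  by rewrite lead_coefC.
have lc0 : 0 < lead_coef (p 0) by have [_ + _] := p_orthonormal; apply.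
set lc := lead_coef (p 0) in pc lc0.
have muA : mu A = (fine (mu A))%:E by rewrite fineK// fin_num_measure.
set r := fine (mu A) in muA.
have r0 : 0 <= r by rewrite -lee_fin -muA.
have key m : r * (lc ^+ 2 * (C ^+ 2) ^+ m) <= ((3 * M) ^+ 2) ^+ m.
  pose g : {poly R} := 'X^(m.*2) * p 0 * p 0.
  have gE x : g.[x] = (x ^+ 2) ^+ m * lc ^+ 2.
    by rewrite /g pc !hornerM hornerXn !hornerC -mul2n exprM -mulrA -expr2.
  have g0 x : 0 <= g.[x].
    by rewrite gE; apply: mulr_ge0; [apply: exprn_ge0|]; exact: sqr_ge0.
  have mg : measurable_fun setT (EFin \o horner g).
    by apply/measurable_EFinP; exact: measurable_horner.
  have Ig : (\int[mu]_x (g.[x])%:E = (jacobi_moment m.*2 0 0)%:E)%E.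
    rewrite jmE /I /Rintegral fineK//.
    by apply: integrable_fin_num => //; exact: integrable_horner.
  have : (\int[mu]_(x in A) (cst (lc ^+ 2 * (C ^+ 2) ^+ m)%:E x) <=
          \int[mu]_x (g.[x])%:E)%E.
    apply: (@le_trans _ _ (\int[mu]_(x in A) (g.[x])%:E)%E).
      apply: ge0_le_integral => //.
      - move=> x _; rewrite lee_fin.
        by apply: mulr_ge0; [|apply: exprn_ge0]; exact: sqr_ge0.
      - exact: measurable_funTS.
      - move=> x; rewrite /A /= in_itv/= -ler_norml => /negP; rewrite -ltNge => Cx.
        rewrite lee_fin gE mulrC ler_wpM2r ?sqr_ge0// lerXn2r ?nnegrE ?sqr_ge0//.
        by rewrite -[leRHS]real_normK ?num_real// lerXn2r ?nnegrE ?(ltW C0)// ltW.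
    by apply: ge0_subset_integral => // x _; rewrite lee_fin.
  have -> : (\int[mu]_(x in A) cst (lc ^+ 2 * (C ^+ 2) ^+ m)%:E x =
      (lc ^+ 2 * (C ^+ 2) ^+ m * r)%:E)%E.
    by rewrite integral_cst// [RHS]EFinM; congr (_ * _)%E; exact: muA.
  rewrite Ig lee_fin mulrC => /le_trans; apply.
  apply: le_trans (ler_norm _) _; apply: le_trans (norm_jacobi_moment _ _ _) _.
  by rewrite -mul2n exprM.
apply: etrans muA _; congr EFin; apply/eqP; rewrite eq_le r0 andbT.
rewrite -(@pmulr_lle0 _ (lc ^+ 2)) ?exprn_gt0//.
pose z := (3 * M) ^+ 2 / C ^+ 2.
have z01 : `|z| < 1.
  rewrite ger0_norm ?divr_ge0 ?sqr_ge0// ltr_pdivrMr ?exprn_gt0// mul1r.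
  by rewrite ltrXn2r ?nnegrE ?mulr_ge0 ?(ltW C0)// ltrDl.
rewrite -(cvg_lim (@Rhausdorff R) (cvg_expr z01)); apply: limr_ge.
- by apply/cvg_ex; exists 0; exact: cvg_expr.
- apply: nearW => m; rewrite /z expr_div_n ler_pdivlMr ?exprn_gt0 ?exprn_gt0//.
  by rewrite -mulrA; exact: key.
Qed.

(** Gershgorin: at a zero [x] of [p k.+1] the values of [p 0, ..., p k] form an
    eigenvector of the truncated Jacobi matrix for the eigenvalue [x]; look at its
    largest entry. *)
Lemma norm_zero_le k x : root (p k.+1) x -> `|x| <= 3 * M.
Proof.
move=> px; have [_ _ rec] := ab_coefs.
pose v (i : 'I_k.+1) : R := `|(p i).[x]|.
pose i := [arg max_(j > ord0 | true) v j]%O.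
have vi j : v j <= v i.
  by rewrite /i; case: arg_maxP => // i' _ /(_ j); apply.
have vl l : (l <= k.+1)%N -> `|(p l).[x]| <= v i.
  rewrite leq_eqVlt => /predU1P[->|lk]; last exact: (vi (Ordinal lk)).
  by rewrite (rootP px) normr0; exact: normr_ge0.
have vi0 : 0 < v i.
  apply: lt_le_trans (vi ord0); rewrite normr_gt0.
  have /size1_polyC -> : (size (p (ord0 : 'I_k.+1)) <= 1)%N by rewrite p_size.
  rewrite hornerC -[0%N]/(1.-1) -(p_size 0) -/(lead_coef _) lead_coef_eq0.
  by rewrite -size_poly_eq0 p_size.
rewrite -(@ler_pM2r _ (v i))// /v -normrM rec.
apply: le_trans (ler_normD _ _) _.
have B u w : `|u| <= M -> `|w| <= v i -> `|u * w| <= M * v i.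
  by move=> uM vM; rewrite normrM ler_pM.
have -> : 3 * M * `|(p i).[x]| = M * v i + M * v i + M * v i by rewrite /v; ring.
have ik := ltn_ord i.
apply: lerD; last first.
  apply: B => //; move: ik; case: (nat_of_ord i) => [|l] lk.
    by rewrite normr0 ltW.
  by apply: vl; rewrite leqW// ltnW.
apply: le_trans (ler_normD _ _) _; apply: lerD; apply: B => //; apply: vl => //.
Qed.

End bounded_coefs.

End orthonormal.

(** * Truncated Jacobi matrices and zeros *)
Section jacobi_matrix.
Context {R : realType}.
Variables (a b : nat -> R) (k : nat).

Definition jacobi_mx : 'M[R]_k.+1 := \matrix_(i, j)
  (b i.+1 *+ (j == i.+1 :> nat) + a i *+ (j == i :> nat) +
   b i *+ (i == j.+1 :> nat)).

Local Notation J := jacobi_mx.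

Lemma jacobi_mx_sym i j : J i j = J j i.
Proof.
have e1 : b i.+1 *+ (j == i.+1 :> nat) = b j *+ (j == i.+1 :> nat).
  by case: eqP => // ->.
have e2 : b i *+ (i == j.+1 :> nat) = b j.+1 *+ (i == j.+1 :> nat).
  by case: eqP => // ->.
have e3 : a i *+ (j == i :> nat) = a j *+ (i == j :> nat).
  by rewrite eq_sym; case: eqP => // ->.
rewrite !mxE e1 e2 e3.
by move: (b j *+ _) (a j *+ _) (b j.+1 *+ _) => X Y Z; ring.
Qed.

Lemma sum_ord_eq n m (u : nat -> R) :
  \sum_(l < n) u l *+ (l == m :> nat) = if (m < n)%N then u m else 0.
Proof.
case: ifPn => [mn|nm].
  rewrite (bigD1 (Ordinal mn))//= eqxx mulr1n big1 ?addr0// => l.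
  by rewrite -val_eqE /= => /negPf ->.
by rewrite big1// => l _; case: eqP => // lm; move: nm; rewrite -lm ltn_ord.
Qed.

Lemma jacobi_mx_row (u : nat -> R) (i : 'I_k.+1) : u k.+1 = 0 ->
  \sum_(l < k.+1) J i l * u l =
  b i.+1 * u i.+1 + a i * u i + b i * (if (i : nat) is i'.+1 then u i' else 0).
Proof.
move=> uk.
under eq_bigr do rewrite !mxE !mulrDl !mulrnAl.
rewrite !big_split/=; congr (_ + _ + _).
- rewrite (sum_ord_eq _ _ (fun l => b i.+1 * u l)); case: ifPn => // h.
  have -> : i.+1 = k.+1 by apply/eqP; rewrite eqn_leq ltn_ord leqNgt.
  by rewrite uk mulr0.
- by rewrite (sum_ord_eq _ _ (fun l => a i * u l)) ltn_ord.
- have := ltn_ord i; case: (nat_of_ord i) => [|i'] hi.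
    by rewrite mulr0 big1.
  under eq_bigr do rewrite eqSS eq_sym.
  by rewrite (sum_ord_eq _ _ (fun l => b i'.+1 * u l)) ltnW.
Qed.

(* The row [i] of the power, continued by zero: the neighbours of a column index
   need not be in range. *)
Let T m (i : 'I_k.+1) (l : nat) : R :=
  if (l < k.+1)%N then (J ^+ m) i (inord l) else 0.

Let TS m i l : (l < k.+1)%N -> T m.+1 i l =
  b l.+1 * T m i l.+1 + a l * T m i l + b l * (if l is l'.+1 then T m i l' else 0).
Proof.
move=> lk; rewrite {1}/T lk exprSr mxE.
have E : \sum_j (J ^+ m) i j * J j (inord l) =
  \sum_(j < k.+1) J (inord l) j * T m i j.
  apply: eq_bigr => j _.
  by rewrite mulrC jacobi_mx_sym /T ltn_ord inord_val.
by rewrite E jacobi_mx_row ?inordK// /T ltnn.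
Qed.

Variable c : nat -> nat -> nat -> R.
Hypothesis c0 : forall i l, c 0 i l = (i == l)%:R.
Hypothesis cS : forall m i l, c m.+1 i l =
  b l.+1 * c m i l.+1 + a l * c m i l + b l * (if l is l'.+1 then c m i l' else 0).

(** In [m] steps to neighbours one does not get from [l <= k - m] past [k], so the
    truncation is not felt. *)
Lemma jacobi_mx_pow_eq m (i l : 'I_k.+1) : (l + m <= k)%N ->
  (J ^+ m) i l = c m i l.
Proof.
suff H n : (n + m <= k)%N -> T m i n = c m i n.
  by move=> /H; rewrite /T ltn_ord inord_val.
elim: m n => [|m IH] n nk.
  have nk' : (n < k.+1)%N by rewrite ltnS; move: nk; rewrite addn0.
  by rewrite /T nk' expr0 mxE c0 -val_eqE /= inordK.
rewrite TS ?cS; last by lia.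
rewrite !IH; [|lia|lia]; congr (_ + _ * _).
by case: n nk => [|n] nk //; apply: IH; lia.
Qed.

Variable M : R.
Hypotheses (aM : forall l, `|a l| <= M) (bM : forall l, `|b l| <= M).
Hypothesis cM : forall m i l, `|c m i l| <= (3 * M) ^+ m.

Let M0 : 0 <= M. Proof. exact: le_trans (aM 0). Qed.

Lemma norm_jacobi_mx_pow m (i l : 'I_k.+1) : `|(J ^+ m) i l| <= (3 * M) ^+ m.
Proof.
suff H n : `|T m i n| <= (3 * M) ^+ m by have := H l; rewrite /T ltn_ord inord_val.
have K0 j : 0 <= (3 * M) ^+ j by rewrite exprn_ge0// mulr_ge0.
elim: m n => [|m IH] n; rewrite /T; case: ifPn => nk; rewrite ?normr0//.
  by rewrite expr0 mxE; case: eqP => _; rewrite ?normr1 ?normr0.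
have := TS m i nk; rewrite {1}/T nk => ->.
apply: le_trans (ler_normD _ _) _.
have B u v : `|u| <= M -> `|v| <= (3 * M) ^+ m -> `|u * v| <= M * (3 * M) ^+ m.
  by move=> uM vM; rewrite normrM ler_pM.
have -> : (3 * M) ^+ m.+1 = M * (3 * M) ^+ m + M * (3 * M) ^+ m + M * (3 * M) ^+ m.
  by rewrite exprS; ring.
apply: lerD; last first.
  by apply: B => //; case: n {nk} => [|n] //; rewrite normr0.
by apply: le_trans (ler_normD _ _) _; apply: lerD; apply: B.
Qed.

Lemma sum_tail_count n m : (\sum_(l < n) (n <= l + m) = minn m n)%N.
Proof.
elim: n => [|n IH]; first by rewrite big_ord0 minn0.
rewrite big_ord_recl/= add0n; under eq_bigr do rewrite /bump/= add1n addSn ltnS.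
by rewrite IH; case: leqP; lia.
Qed.

(** Only the last [m] diagonal entries feel the truncation; the bound does not
    depend on the size of the matrix. *)
Lemma trace_jacobi_mx_pow m :
  `|\tr (J ^+ m) - \sum_(l < k.+1) c m l l| <= m%:R * (2 * (3 * M) ^+ m).
Proof.
have K0 : 0 <= (3 * M) ^+ m by rewrite exprn_ge0// mulr_ge0.
rewrite /mxtrace -sumrB; apply: le_trans (ler_norm_sum _ _ _) _.
apply: (@le_trans _ _ (\sum_(l < k.+1) (k.+1 <= l + m)%:R * (2 * (3 * M) ^+ m))).
  apply: ler_sum => l _; have [lk|lk] := leqP k.+1 (l + m).
    rewrite mul1r (le_trans (ler_normB _ _))// mulr_natl mulr2n.
    by rewrite lerD// norm_jacobi_mx_pow.
  rewrite ltnS in lk; by rewrite (jacobi_mx_pow_eq _ lk) subrr normr0 mul0r.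
rewrite -mulr_suml -natr_sum sum_tail_count ler_wpM2r ?mulr_ge0//.
by rewrite ler_nat geq_minl.
Qed.

End jacobi_matrix.

Section zeros.
Context {R : realType}.
Variable (mu : {finite_measure set R -> \bar R}).
Variables (p : nat -> {poly R}) (a b : nat -> R).
Hypothesis mu_bounded : on_bounded_interval mu.
Hypothesis mu_infinite : infinite_set (msupport mu).
Hypothesis p_orthonormal : orthonormal_polys mu p.
Hypothesis ab_coefs : recurrence_coefs p a b.

Lemma root_op_zero n j : (0 < j <= n)%N -> root (p n) (op_zero p n j).
Proof.
case: j => //= j jn; rewrite -(mem_rootsR_op p_orthonormal) /op_zero mem_nth//=.
by rewrite (size_rootsR_op mu_bounded).
Qed.

(** The matrix [V] of the values of [p 0, ..., p k] at the zeros of [p k.+1]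
    diagonalizes the truncated Jacobi matrix.  It is invertible since a combination
    of [p 0, ..., p k] that vanishes at [k.+1] distinct points is zero. *)
Lemma sum_op_zero_pow k m :
  \sum_(i < k.+1) op_zero p k.+1 i.+1 ^+ m = \tr (jacobi_mx a b k ^+ m).
Proof.
pose x (i : 'I_k.+1) := op_zero p k.+1 i.+1.
have rx i : root (p k.+1) (x i) by apply: root_op_zero; rewrite /= ltn_ord.
have x_inj : injective x.
  move=> i j /eqP; rewrite /x /op_zero/= nth_uniq ?(size_rootsR_op mu_bounded)//.
    by move/eqP/val_inj.
  exact: uniq_rootsR_op.
pose V : 'M[R]_k.+1 := \matrix_(l, j) (p l).[x j].
pose D : 'M[R]_k.+1 := diag_mx (\row_j x j).
have JV : jacobi_mx a b k * V = V * D.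
  apply/matrixP => i j; rewrite -[V * D]/(V *m D) mul_mx_diag !mxE.
  have [_ _ rec] := ab_coefs.
  rewrite mulrC rec.
  under eq_bigr do rewrite [V _ _]mxE.
  rewrite (jacobi_mx_row _ _ _ (u := fun l => (p l).[x j])) //.
  exact/rootP.
have Vu : V \is a GRing.unit.
  change (V \in unitmx).
  rewrite -row_free_unit; apply: inj_row_free => v vV.
  pose q := \sum_(l < k.+1) v 0 l *: p l.
  have qx j : root q (x j).
    apply/rootP; rewrite horner_sum; transitivity ((v *m V) 0 j).
      by rewrite mxE; apply: eq_bigr => l _; rewrite hornerZ mxE.
    by rewrite vV mxE.
  have q0 : q = 0.
    apply: (@roots_geq_poly_eq0 _ q [seq x j | j <- enum 'I_k.+1]).
    - by apply/allP => _ /mapP [j _ ->].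
    - by rewrite map_inj_uniq ?enum_uniq.
    - rewrite size_map size_enum_ord.
      have [psize _ _] := p_orthonormal.
      apply: leq_trans (size_sum _ _ _) _; apply/bigmax_leqP => l _.
      by apply: leq_trans (size_scale_leq _ _) _; rewrite psize.
  apply/rowP => i; rewrite mxE.
  exact: (orthonormal_polys_free mu_bounded p_orthonormal q0).
have JmV n : jacobi_mx a b k ^+ n * V = V * D ^+ n.
  elim: n => [|n IH]; first by rewrite !expr0 mul1r mulr1.
  by rewrite exprSr -mulrA JV mulrA IH -mulrA -exprSr.
have Dm n : D ^+ n = diag_mx (\row_j (x j ^+ n)).
  elim: n => [|n IH]; first by apply/matrixP => i j; rewrite expr0 !mxE.
  rewrite exprSr IH; apply/matrixP => i j.
  rewrite -[_ * D]/(_ *m D) mul_diag_mx !mxE.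
  by case: eqP => [->|_]; rewrite ?mulr1n ?mulr0n ?mulr0// exprSr.
have -> : jacobi_mx a b k ^+ m = V * D ^+ m / V by rewrite -JmV mulrK.
rewrite [V * _ / V]/(V *m D ^+ m *m invmx V) mxtrace_mulC mulmxA mulVmx ?mul1mx//.
by rewrite Dm mxtrace_diag; apply: eq_bigr => i _; rewrite mxE.
Qed.

End zeros.

(** * Squared and Christoffel-Darboux densities *)
Section sqr_measures.
Context {R : realType}.
Variable (mu : {finite_measure set R -> \bar R}).
Variables (p : nat -> {poly R}).
Hypothesis mu_bounded : on_bounded_interval mu.
Hypothesis p_orthonormal : orthonormal_polys mu p.

Definition sqr_measure l : {measure set R -> \bar R} :=
  mdensity mu (poly_sqr_ge0 (p l)) (measurable_poly_sqr (p l)).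

Definition cd_measure k : {measure set R -> \bar R} :=
  mdensity mu (cd_kernel_ge0 p k) (measurable_cd_kernel p k).

Let continuous_sqr l : continuous (fun x : R => (p l).[x] ^+ 2).
Proof.
have -> : (fun x : R => (p l).[x] ^+ 2) = horner (p l ^+ 2).
  by apply/funext => x; rewrite horner_exp.
exact: continuous_horner.
Qed.

Lemma sqr_measure_setT l : sqr_measure l setT = 1%E.
Proof.
rewrite /= /mdensity.
have [_ _ /(_ l l)] := p_orthonormal; rewrite eqxx => <-.
by apply: eq_integral => x _; rewrite expr2.
Qed.

Lemma sqr_measure_pow m l :
  \int[sqr_measure l]_x (x ^+ m) = jacobi_moment mu p m l l.
Proof.
rewrite /Rintegral integral_mdensity; last first.
  exact: continuous_measurable_fun (@continuous_expr _ m).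
by congr fine; apply: eq_integral => x _; rewrite expr2 mulrA.
Qed.

Variable C : R.
Hypotheses (C0 : 0 <= C) (tmu : tame C mu).

Lemma tame_sqr_measure l : tame C (sqr_measure l).
Proof. by apply: tame_mdensity => //; exact: continuous_sqr. Qed.

Lemma mean_on_sqr_measure l : mean_on C (fun f => \int[sqr_measure l]_x f x).
Proof.
apply: mean_on_integral => //; first exact: sqr_measure_setT.
exact: (tame_sqr_measure l).2.
Qed.

Lemma cd_measureE k A : measurable A ->
  cd_measure k A = msum (fun l => mscale 1%:nng (sqr_measure l)) k.+1 A.
Proof.
move=> mA; rewrite /= /msum /mdensity.
have -> : (\int[mu]_(x in A) (cd_kernel p k x x)%:E =
  \int[mu]_(x in A) \sum_(l < k.+1) ((p l).[x] ^+ 2)%:E)%E.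
  by apply: eq_integral => x _; rewrite sumEFin /cd_kernel.
rewrite ge0_integral_sum//.
- by apply: eq_bigr => l _; rewrite /mscale -[LHS]mul1e; congr (_ * _)%E.
- move=> l; apply/measurable_funTS/measurable_EFinP; exact: measurable_poly_sqr.
- by move=> l x _; rewrite lee_fin sqr_ge0.
Qed.

Lemma tame_cd_measure k : tame C (cd_measure k).
Proof.
have h : tame C (msum (fun l => mscale 1%:nng (sqr_measure l)) k.+1).
  by apply: tame_msum => l _; apply: tame_mscale; exact: tame_sqr_measure.
split; rewrite cd_measureE;
  [exact: h.1|exact: measurableT|exact: h.2|exact: measurable_outside].
Qed.

Lemma integral_cd_measure k f : continuous f ->
  \int[cd_measure k]_x f x = \sum_(l < k.+1) \int[sqr_measure l]_x f x.
Proof.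
move=> cf; rewrite {1}/Rintegral.
rewrite (eq_measure_integral
  (msum (fun l => mscale 1%:nng (sqr_measure l)) k.+1)); last first.
  by move=> A mA _; exact: cd_measureE.
rewrite (@integral_mscale_msum _ sqr_measure (fun=> 1%:nng)) /=; last first.
  by move=> l _; exact: (tame_integrable C0 (tame_sqr_measure l) cf).
by apply: eq_bigr => l _; rewrite mul1r.
Qed.

End sqr_measures.

(** * Noerlund averages *)
Section averages.
Context {R : realType}.

(** A regular method preserves limits: finitely many terms have vanishing weights,
    the others are close to [l]. *)
Lemma toeplitz (v : nat -> nat -> R) (u : nat -> R) (l : R) :
  regular_method v -> u n @[n --> \oo] --> l ->
  \sum_(i < n.+1) v n i * u i @[n --> \oo] --> l.
Proof.
move=> [v0 v1 vcvg] ul.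
apply/cvgrPdist_le => e e0; have e2 : 0 < e / 2 by rewrite divr_gt0.
move/cvgrPdist_le : (ul) => /(_ _ e2) [K _ uK].
have : \sum_(i < K) v n i * `|l - u i| @[n --> \oo] --> \sum_(i < K) 0 * `|l - u i|.
  by apply: cvg_sumr => i; apply: cvgM; [exact: vcvg|exact: cvg_cst].
rewrite [X in _ --> X]big1; last by move=> i _; rewrite mul0r.
move=> /cvgrPdist_le /(_ _ e2) head.
near=> n.
have Kn : (K <= n.+1)%N by apply: leqW; near: n; exact: nbhs_infty_ge.
have -> : l - \sum_(i < n.+1) v n i * u i = \sum_(i < n.+1) v n i * (l - u i).
  under [RHS]eq_bigr do rewrite mulrBr; rewrite sumrB; congr (_ - _).
  by rewrite -mulr_suml v1 mul1r.
apply: le_trans (ler_norm_sum _ _ _) _; rewrite [leRHS]splitr.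
apply: (@le_trans _ _ (\sum_(i < n.+1)
  ((if (i < K)%N then v n i * `|l - u i| else 0) + v n i * (e / 2)))).
  apply: ler_sum => i _; have vi := v0 n i (ltn_ord i).
  rewrite normrM (ger0_norm vi); case: ifPn => iK.
    by rewrite lerDl mulr_ge0// ltW.
  by rewrite add0r ler_wpM2l//; apply: uK; rewrite /= leqNgt.
rewrite big_split/= -mulr_suml v1 mul1r lerD2r.
rewrite -big_mkcond/= -(big_ord_widen n.+1 (fun i => v n i * `|l - u i|))//.
have : `|0 - \sum_(i < K) v n i * `|l - u i| | <= e / 2 by near: n.
by rewrite sub0r normrN => /(le_trans (ler_norm _)).
Unshelve. all: by end_near. Qed.

(** Both sides run over the pairs [(j, l)] with [j + l <= n], by [j = n - k] on the
    left and by [j + l = i] on the right. *)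
Lemma triangle_sum (G : nat -> nat -> R) n :
  \sum_(k < n.+1) \sum_(l < k.+1) G (n - k)%N l =
  \sum_(i < n.+1) \sum_(l < i.+1) G (i - l)%N l.
Proof.
elim: n => [|n IH]; first by rewrite !(big_ord_recl, big_ord0).
rewrite [RHS]big_ord_recr/= -IH.
under eq_bigr do rewrite big_ord_recr/=.
rewrite big_split/=; congr (_ + _).
rewrite big_ord_recl/= big_ord0 add0r; apply: eq_bigr => k _.
by rewrite /bump/= add1n subSS.
Qed.

End averages.

Section norlund.
Context {R : realType}.
Variables (tau sg : nat -> {nonneg R}).
Hypothesis S_regular : regular_method (fun n k => (norlund_weight tau sg n k)%:num).

Local Notation w n k := ((norlund_weight tau sg n k)%:num).
Local Notation t n := ((tau n)%:num : R).
Local Notation s n := ((sg n)%:num : R).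
Local Notation N n := ((norlund_mean tau n)%:num).

Lemma norlund_weightE n k : w n k = t n * s (n - k)%N.
Proof. by []. Qed.

Lemma sum_norlund_weight n : \sum_(k < n.+1) w n k = 1.
Proof. by have [_ + _] := S_regular; apply. Qed.

Lemma norlund_tau_sum n : t n * \sum_(k < n.+1) s k = 1.
Proof.
rewrite -[RHS](sum_norlund_weight n) mulr_sumr (reindex_inj rev_ord_inj)/=.
apply: eq_bigr => k _; rewrite norlund_weightE; congr (_ * (sg _)%:num).
Qed.

Lemma norlund_tau_gt0 n : 0 < t n.
Proof.
rewrite lt_neqAle ge0 andbT eq_sym; apply/negP => /eqP t0.
by have := norlund_tau_sum n; rewrite t0 mul0r => /esym/eqP; rewrite oner_eq0.
Qed.

Lemma norlund_tauV n : (t n)^-1 = \sum_(k < n.+1) s k.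
Proof.
by rewrite -[LHS]mulr1 -(norlund_tau_sum n) mulKf// gt_eqF// norlund_tau_gt0.
Qed.

Lemma norlund_tau_le n : t n <= t 0.
Proof.
rewrite -lef_pV2 ?posrE ?norlund_tau_gt0// !norlund_tauV.
by rewrite big_ord1 big_ord_recl lerDl sumr_ge0.
Qed.

Lemma norlund_meanE n : N n = t n * \sum_(k < n.+1) (t k)^-1.
Proof. by []. Qed.

Lemma norlund_mean_gt0 n : 0 < N n.
Proof.
rewrite norlund_meanE mulr_gt0 ?norlund_tau_gt0// big_ord_recl ltr_pwDl//.
  by rewrite invr_gt0 norlund_tau_gt0.
by rewrite sumr_ge0.
Qed.

(** One step: [1 - t n.+1 / t n] is the weight of index [0] at [n.+1]. *)
Lemma norlund_tau_ratio m : t (n + m)%N / t n @[n --> \oo] --> (1 : R).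
Proof.
have step : t n.+1 / t n @[n --> \oo] --> (1 : R).
  have E n : t n.+1 / t n = 1 - w n.+1 0.
    have /eqP := norlund_tau_sum n.+1; rewrite big_ord_recr/= -norlund_tauV.
    by rewrite mulrDr norlund_weightE subn0 => /eqP <-; rewrite addrK.
  have -> : (fun n => t n.+1 / t n) = (fun n => 1 - w n.+1 0) by apply/funext.
  suff : 1 - w n.+1 0 @[n --> \oo] --> (1 - 0 : R) by rewrite subr0.
  apply: (@cvgB _ R^o); first exact: cvg_cst.
  have [_ _ /(_ 0)] := S_regular.
  by rewrite -(cvg_shiftS (fun n => w n 0)).
elim: m => [|m IH].
  have -> : (fun n => t (n + 0)%N / t n) = cst 1; last exact: cvg_cst.
  by apply/funext => n; rewrite addn0 divff// gt_eqF// norlund_tau_gt0.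
have E n : t (n + m.+1)%N / t n = (t (n + m).+1 / t (n + m)%N) * (t (n + m)%N / t n).
  by rewrite addnS mulrA divfK// gt_eqF// norlund_tau_gt0.
have -> : (fun n => t (n + m.+1)%N / t n) =
  (fun n => (t (n + m).+1 / t (n + m)%N) * (t (n + m)%N / t n)) by apply/funext.
rewrite -[1](mulr1 (1 : R)); apply: cvgM => //.
by move: step; rewrite -(cvg_shiftn m (fun n => t n.+1 / t n)).
Qed.

Hypothesis N_infty : N n @[n --> \oo] --> +oo.

Lemma norlund_mean_inv_cvg0 : (N n)^-1 @[n --> \oo] --> (0 : R).
Proof. apply/(@gtr0_cvgV0 _ _ _ _ (fun n => N n)) => //.
by apply: nearW => n; exact: norlund_mean_gt0. Qed.

(** The share of the [i]-th averaged squared measure in the [n]-th averaged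
    Christoffel-Darboux measure, see [cesaro_weight_sum]. *)
Definition cesaro_weight n i : R := (N n)^-1 * (t n / t i).

(** Here the divergence of the means [N n] enters: it sends each weight to zero. *)
Lemma regular_cesaro_weight : regular_method cesaro_weight.
Proof.
split=> [n k _|n|k].
- by rewrite mulr_ge0 ?divr_ge0 ?invr_ge0.
- rewrite /cesaro_weight -mulr_sumr -mulr_sumr -norlund_meanE mulVf//.
  by rewrite gt_eqF// norlund_mean_gt0.
- have h0 n : 0 <= (N n)^-1 by rewrite invr_ge0 ltW// norlund_mean_gt0.
  apply: (@squeeze_cvgr _ _ _ _ (fun=> 0) (fun n => (N n)^-1 * (t 0 / t k))).
  + apply: nearW => n; apply/andP; split.
      by apply: mulr_ge0 => //; exact: divr_ge0.
    by apply: ler_wpM2l => //; rewrite ler_wpM2r ?invr_ge0// norlund_tau_le.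
  + exact: cvg_cst.
  + rewrite -[X in _ --> X](mul0r (t 0 / t k)); apply: cvgM; last exact: cvg_cst.
    exact: norlund_mean_inv_cvg0.
Qed.

Lemma cesaro_weight_sum (E : nat -> nat -> R) n :
  (N n)^-1 * \sum_(k < n.+1) w n k * \sum_(l < k.+1) E (n - k)%N l =
  \sum_(i < n.+1) cesaro_weight n i * \sum_(l < i.+1) w i l * E (i - l)%N l.
Proof.
transitivity ((N n)^-1 *
  (t n * \sum_(k < n.+1) \sum_(l < k.+1) s (n - k)%N * E (n - k)%N l)).
  congr (_ * _); rewrite mulr_sumr; apply: eq_bigr => k _.
  by rewrite norlund_weightE -mulrA mulr_sumr.
rewrite (triangle_sum (fun j l => s j * E j l)) mulrA mulr_sumr.
apply: eq_bigr => i _; rewrite /cesaro_weight !mulr_sumr; apply: eq_bigr => l _.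
rewrite norlund_weightE; field.
by rewrite !gt_eqF ?norlund_mean_gt0 ?norlund_tau_gt0.
Qed.

End norlund.

(** * Convergence of the averaged moments in the mean Nevai class *)
Section nevai_moments.
Context {R : realType}.
Variables (tau sg : nat -> {nonneg R}) (a b : nat -> nat -> R).
Variable Sigma : nat -> nat -> R.
Hypothesis S_regular : regular_method (fun n k => (norlund_weight tau sg n k)%:num).
Hypothesis ab_nevai : mean_nevai_class
  (fun n k => (norlund_weight tau sg n k)%:num) Sigma a b.
Variable M : R.
Hypotheses (aM : forall j l, `|a j l| <= M) (bM : forall j l, `|b j l| <= M).

Local Notation w n k := ((norlund_weight tau sg n k)%:num).

Let M0 : 0 <= M. Proof. exact: le_trans (aM 0 0). Qed.

Implicit Types (u v : nat -> nat -> R) (s : seq (R * (nat * nat))).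

(** Negligibility in the average for an array indexed by the number [j] of the
    measure and the degree [k]. *)
Definition mean_null u :=
  \sum_(k < n.+1) w n k * `|u (n - k)%N k| @[n --> \oo] --> (0 : R).

Lemma mean_null_le u v (B : R) : (forall j k, `|u j k| <= B * `|v j k|) ->
  mean_null v -> mean_null u.
Proof.
move=> uv nv.
apply: (@squeeze_cvgr _ _ _ _ (fun=> 0)
  (fun n => B * \sum_(k < n.+1) w n k * `|v (n - k)%N k|)).
- apply: nearW => n; apply/andP; split.
    by apply: sumr_ge0 => k _; rewrite mulr_ge0.
  rewrite mulr_sumr; apply: ler_sum => k _; rewrite mulrCA.
  exact: ler_wpM2l.
- exact: cvg_cst.
- by rewrite -[X in _ --> X](mulr0 B); apply: cvgMr.
Qed.

Lemma mean_nullD u v : mean_null u -> mean_null v ->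
  mean_null (fun j k => u j k + v j k).
Proof.
move=> nu nv.
apply: (@squeeze_cvgr _ _ _ _ (fun=> 0)
  (fun n => \sum_(k < n.+1) w n k * `|u (n - k)%N k| +
            \sum_(k < n.+1) w n k * `|v (n - k)%N k|)).
- apply: nearW => n; apply/andP; split.
    by apply: sumr_ge0 => k _; rewrite mulr_ge0.
  rewrite -big_split; apply: ler_sum => k _ /=; rewrite -mulrDr.
  by apply: ler_wpM2l => //; exact: ler_normD.
- exact: cvg_cst.
- by rewrite -[X in _ --> X](addr0 0); apply: (@cvgD _ R^o).
Qed.

(** A fixed polynomial in [a j k] and [b j k], given by the list of its monomials:
    a coefficient with the exponents of [a] and of [b]. *)
Definition coef_poly s j k : R :=
  \sum_(t <- s) t.1 * (a j k ^+ t.2.1 * b j k ^+ t.2.2).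

(** The averages of such an array converge, see [coef_approx_cvg]. *)
Definition coef_approx u :=
  exists s, mean_null (fun j k => u j k - coef_poly s j k).

Lemma coef_poly_bounded s : exists B : R, forall j k, `|coef_poly s j k| <= B.
Proof.
exists (\sum_(t <- s) `|t.1| * (M ^+ t.2.1 * M ^+ t.2.2)) => j k.
apply: le_trans (ler_norm_sum _ _ _) _; apply: ler_sum => t _.
rewrite normrM; apply: ler_wpM2l => //; rewrite normrM !normrX.
by apply: ler_pM; rewrite ?exprn_ge0// lerXn2r ?nnegrE.
Qed.

Lemma coef_poly_cvg s :
  cvgn (fun n => \sum_(k < n.+1) w n k * coef_poly s (n - k)%N k).
Proof.
have [_ _ lim] := ab_nevai.
apply/cvg_ex; elim: s => [|t s [l IH]].
  exists 0.
  have -> : (fun n => \sum_(k < n.+1) w n k * coef_poly [::] (n - k)%N k) =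
    cst 0.
    by apply/funext => n; rewrite big1// => k _; rewrite /coef_poly big_nil mulr0.
  exact: cvg_cst.
exists (t.1 * Sigma t.2.1 t.2.2 + l).
have -> : (fun n => \sum_(k < n.+1) w n k * coef_poly (t :: s) (n - k)%N k) =
  (fun n => t.1 * (\sum_(k < n.+1) w n k *
       (a (n - k)%N k ^+ t.2.1 * b (n - k)%N k ^+ t.2.2)) +
     \sum_(k < n.+1) w n k * coef_poly s (n - k)%N k).
  apply/funext => n; rewrite mulr_sumr -big_split; apply: eq_bigr => k _ /=.
  by rewrite /coef_poly big_cons mulrDr mulrCA.
by apply: (@cvgD _ R^o) => //; apply: cvgMr; exact: lim.
Qed.

Lemma coef_approx_cvg u : coef_approx u ->
  cvgn (fun n => \sum_(k < n.+1) w n k * u (n - k)%N k).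
Proof.
move=> [s nus]; have /cvg_ex [l sl] := @coef_poly_cvg s.
apply/cvg_ex; exists (0 + l).
have -> : (fun n => \sum_(k < n.+1) w n k * u (n - k)%N k) =
   (fun n => \sum_(k < n.+1) w n k * (u (n - k)%N k - coef_poly s (n - k)%N k) +
             \sum_(k < n.+1) w n k * coef_poly s (n - k)%N k).
  apply/funext => n; rewrite -big_split; apply: eq_bigr => k _ /=.
  by rewrite -mulrDr subrK.
apply: (@cvgD _ R^o) => //; apply: norm_cvg0.
apply: (@squeeze_cvgr _ _ _ _ (fun=> 0)
  (fun n => \sum_(k < n.+1)
     w n k * `|u (n - k)%N k - coef_poly s (n - k)%N k|)) => //.
  apply: nearW => n; apply/andP; split => //.
  apply: le_trans (ler_norm_sum _ _ _) _; apply: ler_sum => k _.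
  by rewrite normrM ger0_norm.
exact: cvg_cst.
Qed.

Lemma coef_approx_cst (c : R) : coef_approx (fun _ _ => c).
Proof.
exists [:: (c, (0%N, 0%N))].
have -> : (fun j k => c - coef_poly [:: (c, (0%N, 0%N))] j k) = (fun _ _ => 0).
  apply/funext => j; apply/funext => k.
  by rewrite /coef_poly big_seq1 !expr0 !mulr1 subrr.
rewrite /mean_null.
under eq_fun do under eq_bigr do rewrite normr0 mulr0.
under eq_fun do rewrite big1//.
exact: cvg_cst.
Qed.

Lemma coef_approxD u v : coef_approx u -> coef_approx v ->
  coef_approx (fun j k => u j k + v j k).
Proof.
move=> [s us] [s' vs]; exists (s ++ s').
have -> : (fun j k => u j k + v j k - coef_poly (s ++ s') j k) =
  (fun j k => (u j k - coef_poly s j k) + (v j k - coef_poly s' j k)).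
  apply/funext => j; apply/funext => k.
  by rewrite /coef_poly big_cat /= opprD addrACA.
exact: mean_nullD us vs.
Qed.

(** [x] is one of [a], [b], [v] is a shifted copy of it, and [f] multiplies a
    monomial by the variable of [x].  Then [v * u - x * P] splits as
    [v * (u - P) + (v - x) * P]. *)
Lemma coef_approxM (x : nat -> nat -> R)
    (f : R * (nat * nat) -> R * (nat * nat)) v u :
  (forall j k, `|v j k| <= M) -> mean_null (fun j k => v j k - x j k) ->
  (forall s j k, coef_poly (map f s) j k = x j k * coef_poly s j k) ->
  coef_approx u -> coef_approx (fun j k => v j k * u j k).
Proof.
move=> vM vx fx [s us]; exists (map f s).
have [B sB] := coef_poly_bounded s.
have n1 : mean_null (fun j k => v j k * (u j k - coef_poly s j k)).
  by apply: mean_null_le us => j k; rewrite normrM ler_wpM2r.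
have n2 : mean_null (fun j k => (v j k - x j k) * coef_poly s j k).
  by apply: mean_null_le vx => j k; rewrite mulrC normrM ler_wpM2r.
have -> : (fun j k => v j k * u j k - coef_poly (map f s) j k) =
  (fun j k => v j k * (u j k - coef_poly s j k) +
              (v j k - x j k) * coef_poly s j k).
  by apply/funext => j; apply/funext => k; rewrite fx; ring.
exact: mean_nullD n1 n2.
Qed.

Lemma mean_null_shift (x : nat -> nat -> R) t :
  (forall l, (0 < l)%N -> mean_null (fun j k => x j (k + l)%N - x j k)) ->
  mean_null (fun j k => x j (k + t)%N - x j k).
Proof.
case: t => [|t] h; last exact: h.
apply: (@mean_null_le _ _ 0 _ (h 1%N isT)) => j k.
by rewrite addn0 subrr normr0 mul0r.
Qed.

Lemma coef_approx_a t u : coef_approx u ->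
  coef_approx (fun j k => a j (k + t)%N * u j k).
Proof.
have [_ shift _] := ab_nevai.
apply: (coef_approxM (x := a) (f := fun y => (y.1, (y.2.1.+1, y.2.2)))) => //.
  by apply: mean_null_shift => l l0; exact: (shift l l0).1.
move=> s j k; rewrite /coef_poly big_map mulr_sumr; apply: eq_bigr => y _ /=.
by rewrite exprS; ring.
Qed.

Lemma coef_approx_b t u : coef_approx u ->
  coef_approx (fun j k => b j (k + t)%N * u j k).
Proof.
have [_ shift _] := ab_nevai.
apply: (coef_approxM (x := b) (f := fun y => (y.1, (y.2.1, y.2.2.+1)))) => //.
  by apply: mean_null_shift => l l0; exact: (shift l l0).2.
move=> s j k; rewrite /coef_poly big_map mulr_sumr; apply: eq_bigr => y _ /=.
by rewrite exprS; ring.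
Qed.

Variable c : nat -> nat -> nat -> nat -> R.
Hypothesis c0 : forall j i l, c j 0 i l = (i == l)%:R.
Hypothesis cS : forall j m i l, c j m.+1 i l =
  b j l.+1 * c j m i l.+1 + a j l * c j m i l +
  b j l * (if l is l'.+1 then c j m i l' else 0).
Hypothesis cM : forall j m i l, `|c j m i l| <= (3 * M) ^+ m.

(** By induction along the recursion of the Jacobi matrix.  Starting [m] columns
    from the left border, the recursion never reaches it in [m] steps, and all the
    coefficients that it uses have indices [k + t'] with [t' >= 0]. *)
Lemma coef_approx_moment m i t : (m <= t)%N ->
  coef_approx (fun j k => c j m (k + i)%N (k + t)%N).
Proof.
elim: m t => [|m IH] t mt.
  have -> : (fun j k => c j 0 (k + i)%N (k + t)%N) = (fun _ _ => (i == t)%:R).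
    by apply/funext => j; apply/funext => k; rewrite c0 eqn_add2l.
  exact: coef_approx_cst.
case: t mt => // t mt.
have -> : (fun j k => c j m.+1 (k + i)%N (k + t.+1)%N) =
   (fun j k => b j (k + t.+2)%N * c j m (k + i)%N (k + t.+2)%N +
     a j (k + t.+1)%N * c j m (k + i)%N (k + t.+1)%N +
     b j (k + t.+1)%N * c j m (k + i)%N (k + t)%N).
  by apply/funext => j; apply/funext => k; rewrite cS !addnS.
apply: coef_approxD; [apply: coef_approxD|].
- by apply: coef_approx_b; apply: IH; lia.
- by apply: coef_approx_a; apply: IH; lia.
- by apply: coef_approx_b; apply: IH; lia.
Qed.

(** Written at [k + m] instead of [k], the diagonal entries are of the form
    controlled by [coef_approx_moment].  This leaves out the first [m] terms, whose
    weights tend to zero, and replaces the weights at [n + m] by those at [n], which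
    multiplies them by a factor that tends to [1]. *)
Lemma mean_moment_cvg m :
  cvgn (fun n => \sum_(k < n.+1) w n k * c (n - k)%N m k k).
Proof.
have /coef_approx_cvg /cvg_ex [l Al] := coef_approx_moment m (leqnn m).
apply/cvg_ex; exists (0 + 1 * l).
rewrite -(cvg_shiftn m).
have -> : [sequence \sum_(k < (n + m).+1) w (n + m)%N k * c (n + m - k)%N m k k]_n =
  (fun n => \sum_(k < m) w (n + m)%N k * c (n + m - k)%N m k k +
     ((tau (n + m)%N)%:num / (tau n)%:num) *
       \sum_(k < n.+1) w n k * c (n - k)%N m (k + m)%N (k + m)%N).
  apply/funext => n /=.
  rewrite (_ : (n + m).+1 = m + n.+1)%N; last by lia.
  rewrite big_split_ord/=; congr (_ + _); rewrite mulr_sumr; apply: eq_bigr => k _.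
  rewrite !(norlund_weightE) (_ : n + m - (m + k) = n - k)%N; last by lia.
  rewrite (addnC m k) !mulrA divfK//.
  by rewrite gt_eqF// (norlund_tau_gt0 S_regular).
apply: (@cvgD _ R^o); last first.
  by apply: cvgM => //; exact: (norlund_tau_ratio S_regular m).
rewrite -[X in _ --> X](_ : \sum_(k < m) (0 : R) = 0); last by rewrite big1.
apply: cvg_sumr => k; apply: norm_cvg0.
have [_ _ /(_ k) wk] := S_regular.
apply: (@squeeze_cvgr _ _ _ _ (fun=> 0) (fun n => w (n + m)%N k * (3 * M) ^+ m)).
- apply: nearW => n; rewrite normr_ge0/= normrM ger0_norm//.
  exact: ler_wpM2l.
- exact: cvg_cst.
- rewrite -[X in _ --> X](mul0r ((3 * M) ^+ m)); apply: cvgM; last exact: cvg_cst.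
  by move: wk; rewrite -(cvg_shiftn m (fun n => w n k)).
Qed.

End nevai_moments.

(** * Averages of the measures and of the zeros *)
Section averaged.
Context {R : realType}.
Variable (mu : nat -> {finite_measure set R -> \bar R}).
Variables (p : nat -> nat -> {poly R}) (a b : nat -> nat -> R).
Variables (tau sg : nat -> {nonneg R}) (Sigma : nat -> nat -> R).
Hypothesis mu_bounded : forall k, on_bounded_interval (mu k).
Hypothesis mu_infinite : forall k, infinite_set (msupport (mu k)).
Hypothesis p_orthonormal : forall k, orthonormal_polys (mu k) (p k).
Hypothesis ab_coefs : forall k, recurrence_coefs (p k) (a k) (b k).
Hypothesis S_regular :
  regular_method (fun n k => (norlund_weight tau sg n k)%:num).
Hypothesis N_infty : (norlund_mean tau n)%:num @[n --> \oo] --> +oo.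
Hypothesis mu_nevai : mean_nevai_class
  (fun n k => (norlund_weight tau sg n k)%:num) Sigma a b.
Variable M : R.
Hypotheses (aM : forall j l, `|a j l| <= M) (bM : forall j l, `|b j l| <= M).

Local Notation w n k := ((norlund_weight tau sg n k)%:num).
Local Notation N n := ((norlund_mean tau n)%:num).
Implicit Types f : R -> R.

Let M0 : 0 <= M. Proof. exact: le_trans (aM 0 0). Qed.
Let C := 3 * M + 1.
Let C0 : 0 < C. Proof. by rewrite /C; have := M0; lra. Qed.

Let tmu j : tame C (mu j).
Proof.
exact: (tame_of_bounded_coefs (mu_bounded j) (p_orthonormal j)
  (ab_coefs j) (aM j) (bM j)).
Qed.

Definition sqr_mean j l f := \int[sqr_measure (mu j) (p j) l]_x f x.

Definition avg_sqr n f := \sum_(k < n.+1) w n k * sqr_mean (n - k) k f.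

Definition avg_cd n f :=
  (N n)^-1 * \sum_(k < n.+1) w n k * \sum_(l < k.+1) sqr_mean (n - k) l f.

Definition avg_zero n f :=
  (N n)^-1 * \sum_(k < n.+1) w n k *
    \sum_(i < k.+1) f (op_zero (p (n - k)%N) k.+1 i.+1).

Let mean_on_sqr j l : mean_on C (sqr_mean j l).
Proof. exact: (mean_on_sqr_measure (p_orthonormal j) (ltW C0) (tmu j)). Qed.

Lemma mean_on_avg_sqr n : mean_on C (avg_sqr n).
Proof.
apply: (@mean_convex _ _ _ (fun k => w n k) (fun k => sqr_mean (n - k) k)) => //.
exact: (sum_norlund_weight S_regular).
Qed.

Lemma avg_cdE n f :
  avg_cd n f = \sum_(i < n.+1) cesaro_weight tau n i * avg_sqr i f.
Proof. exact: (cesaro_weight_sum S_regular (fun j l => sqr_mean j l f)). Qed.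

Lemma mean_on_avg_cd n : mean_on C (avg_cd n).
Proof.
have -> : avg_cd n = (fun f => \sum_(i < n.+1) cesaro_weight tau n i * avg_sqr i f).
  by apply/funext => f; exact: avg_cdE.
have [v0 v1 _] := regular_cesaro_weight S_regular N_infty.
apply: mean_convex => // [k kn|k _]; first exact: v0.
exact: mean_on_avg_sqr.
Qed.

Let zero_bound j k i : (0 < i <= k.+1)%N -> `|op_zero (p j) k.+1 i| <= C.
Proof.
move=> ik; apply: (@le_trans _ _ (3 * M)); last by rewrite lerDl.
apply: (norm_zero_le (p_orthonormal j) (ab_coefs j) (aM j) (bM j) (k := k)).
exact: (root_op_zero (mu_bounded j) (@mu_infinite j) (p_orthonormal j) ik).
Qed.

(** The total mass is the one of [avg_cd n]: both count [k.+1] units for each [k]. *)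
Lemma mean_on_avg_zero n : mean_on C (avg_zero n).
Proof.
split => [c f g cf cg||f cf f0].
- rewrite /avg_zero.
  pose Z h := \sum_(k < n.+1) w n k *
    \sum_(i < k.+1) h (op_zero (p (n - k)%N) k.+1 i.+1).
  suff ZD : Z (fun x => c * f x + g x) = c * Z f + Z g.
    transitivity ((N n)^-1 * (c * Z f + Z g)); first by rewrite -ZD.
    by rewrite mulrDr mulrCA.
  rewrite mulr_sumr -big_split; apply: eq_bigr => k _ /=.
  by rewrite [in LHS]big_split -[in LHS]mulr_sumr mulrDr mulrCA.
- have [_ cd1 _] := mean_on_avg_cd n; rewrite -[RHS]cd1; congr (_ * _).
  apply: eq_bigr => k _.
  by congr (_ * _); apply: eq_bigr => l _; have [_ -> _] := mean_on_sqr (n - k) l.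
- rewrite mulr_ge0 ?invr_ge0//; apply: sumr_ge0 => k _; rewrite mulr_ge0//.
  by apply: sumr_ge0 => i _; apply: f0; apply: zero_bound; rewrite /= ltn_ord.
Qed.

Let c j m k l := jacobi_moment (mu j) (p j) m k l.

Lemma avg_sqr_moment_cvg m : cvgn (fun n => avg_sqr n (fun x => x ^+ m)).
Proof.
have -> : (fun n => avg_sqr n (fun x => x ^+ m)) =
   (fun n => \sum_(k < n.+1) w n k * c (n - k)%N m k k).
  apply/funext => n; apply: eq_bigr => k _; congr (_ * _).
  exact: sqr_measure_pow.
apply: (mean_moment_cvg S_regular mu_nevai aM bM) => [j i l|j m' i l|j m' i l].
- exact: jacobi_moment0.
- exact: jacobi_momentS.
- exact: (norm_jacobi_moment (mu_bounded j) (p_orthonormal j)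
    (ab_coefs j) (aM j) (bM j)).
Qed.

Lemma avg_sqr_cvg f : continuous f -> cvgn (fun n => avg_sqr n f).
Proof.
exact: (mean_moments_is_cvg C0 mean_on_avg_sqr avg_sqr_moment_cvg).
Qed.

Lemma avg_cd_cvg f (l : R) : avg_sqr n f @[n --> \oo] --> l ->
  avg_cd n f @[n --> \oo] --> l.
Proof.
have -> : (fun n => avg_cd n f) =
   (fun n => \sum_(i < n.+1) cesaro_weight tau n i * avg_sqr i f).
  by apply/funext => n; exact: avg_cdE.
exact: (toeplitz (regular_cesaro_weight S_regular N_infty)).
Qed.

(** For each [k] the two sums differ by at most a constant that depends on [m]
    only, and the weights sum to one before the division by [N n]. *)
Lemma avg_zero_cd_moment m :
  avg_zero n (fun x => x ^+ m) - avg_cd n (fun x => x ^+ m) @[n --> \oo] --> 0.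
Proof.
pose K : R := m%:R * (2 * (3 * M) ^+ m).
apply: norm_cvg0; apply: (@squeeze_cvgr _ _ _ _ (fun=> 0) (fun n => (N n)^-1 * K)).
- apply: nearW => n; rewrite normr_ge0/=.
  rewrite /avg_zero /avg_cd -mulrBr normrM ger0_norm ?invr_ge0//.
  rewrite ler_wpM2l ?invr_ge0// -sumrB.
  apply: le_trans (ler_norm_sum _ _ _) _.
  rewrite -[leRHS]mul1r -(sum_norlund_weight S_regular n) mulr_suml.
  apply: ler_sum => k _; rewrite -mulrBr normrM ger0_norm// ler_wpM2l//.
  rewrite (sum_op_zero_pow (mu_bounded _) (@mu_infinite _)
    (p_orthonormal _) (ab_coefs _)).
  have -> : \sum_(l < k.+1) sqr_mean (n - k) l (fun x => x ^+ m) =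
    \sum_(l < k.+1) c (n - k)%N m l l.
    by apply: eq_bigr => l _; exact: sqr_measure_pow.
  apply: (@trace_jacobi_mx_pow _ _ _ _ (c (n - k)%N)) => // [i l|m' i l|m' i l].
  + exact: jacobi_moment0.
  + exact: jacobi_momentS.
  + exact: (norm_jacobi_moment (mu_bounded _) (p_orthonormal _)
      (ab_coefs _) (aM _) (bM _)).
- exact: cvg_cst.
- rewrite -[X in _ --> X](mul0r K); apply: cvgM; last exact: cvg_cst.
  exact: (norlund_mean_inv_cvg0 S_regular N_infty).
Qed.

Lemma avg_zero_cvg f (l : R) : continuous f -> avg_sqr n f @[n --> \oo] --> l ->
  avg_zero n f @[n --> \oo] --> l.
Proof.
move=> cf /avg_cd_cvg cdl.
have zcd :=
  mean_moments_cvg C0 mean_on_avg_zero mean_on_avg_cd avg_zero_cd_moment cf.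
rewrite -[l]add0r.
have -> : (fun n => avg_zero n f) =
  (fun n => (avg_zero n f - avg_cd n f) + avg_cd n f).
  by apply/funext => n; rewrite subrK.
exact: (@cvgD _ R^o).
Qed.

Lemma tame_mean_sqr n : tame C (mean_sqr_measure mu p tau sg n).
Proof.
apply: tame_msum => k _; apply: tame_mscale.
exact: (tame_sqr_measure (p (n - k)%N) (ltW C0) (tmu (n - k)%N) k).
Qed.

Lemma integral_mean_sqr n f : continuous f ->
  (\int[mean_sqr_measure mu p tau sg n]_x (f x)%:E = (avg_sqr n f)%:E)%E.
Proof.
move=> cf; rewrite (tame_integralE (ltW C0) (tame_mean_sqr n) cf); congr EFin.
have tk k : tame C (sqr_measure (mu (n - k)%N) (p (n - k)%N) k).
  exact: (tame_sqr_measure (p (n - k)%N) (ltW C0) (tmu (n - k)%N) k).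
rewrite (tame_integral_msum (ltW C0) _ cf); last first.
  by move=> k _; apply: tame_mscale; exact: tk.
apply: eq_bigr => k _.
exact: (tame_integral_mscale _ (ltW C0) (tk k) cf).
Qed.

Lemma integral_mean_cd n f : continuous f ->
  (\int[mean_cd_measure mu p tau sg n]_x (f x)%:E = (avg_cd n f)%:E)%E.
Proof.
move=> cf.
have tk k : tame C (cd_measure (mu (n - k)%N) (p (n - k)%N) k).
  exact: (tame_cd_measure (p (n - k)%N) (ltW C0) (tmu (n - k)%N) k).
have tS : tame C (msum (fun k => mscale (norlund_weight tau sg n k)
    (cd_measure (mu (n - k)%N) (p (n - k)%N) k)) n.+1).
  by apply: tame_msum => k _; apply: tame_mscale; exact: tk.
have tN : tame C (mean_cd_measure mu p tau sg n) by apply: tame_mscale; exact: tS.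
rewrite (tame_integralE (ltW C0) tN cf); congr EFin.
apply: etrans (tame_integral_mscale _ (ltW C0) tS cf) _; congr (_ * _).
rewrite (tame_integral_msum (ltW C0) _ cf); last first.
  by move=> k _; apply: tame_mscale; exact: tk.
apply: eq_bigr => k _; rewrite (tame_integral_mscale _ (ltW C0) (tk k) cf).
congr (_ * _).
exact: (integral_cd_measure _ (ltW C0) (tmu (n - k)%N) k cf).
Qed.

Lemma integral_mean_zero n f : continuous f ->
  (\int[mean_zero_measure p tau sg n]_x (f x)%:E = (avg_zero n f)%:E)%E.
Proof.
move=> cf.
have td k i : (i < k.+1)%N -> tame C (dirac (op_zero (p (n - k)%N) k.+1 i.+1)).
  by move=> ik; apply: tame_dirac; exact: zero_bound.
have tk k : tame C (msum (fun i => dirac (op_zero (p (n - k)%N) k.+1 i.+1)) k.+1).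
  by apply: tame_msum => i ik; exact: td.
have tS : tame C (msum (fun k => mscale (norlund_weight tau sg n k)
    (msum (fun i => dirac (op_zero (p (n - k)%N) k.+1 i.+1)) k.+1)) n.+1).
  by apply: tame_msum => k _; apply: tame_mscale; exact: tk.
have tN : tame C (mean_zero_measure p tau sg n) by apply: tame_mscale; exact: tS.
rewrite (tame_integralE (ltW C0) tN cf); congr EFin.
apply: etrans (tame_integral_mscale _ (ltW C0) tS cf) _; congr (_ * _).
rewrite (tame_integral_msum (ltW C0) _ cf); last first.
  by move=> k _; apply: tame_mscale; exact: tk.
apply: eq_bigr => k _; rewrite (tame_integral_mscale _ (ltW C0) (tk k) cf).
congr (_ * _); rewrite (tame_integral_msum (ltW C0) _ cf); last first.
  by move=> i ik; exact: td.
apply: eq_bigr => i _; rewrite /Rintegral integral_dirac//.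
  by rewrite diracT mul1e.
by apply/measurable_EFinP; exact: continuous_measurable_fun.
Qed.

Lemma mean_sqr_setT n : mean_sqr_measure mu p tau sg n setT = 1%E.
Proof.
have := integral_mean_sqr n (@continuous_cst _ 1).
have [_ -> _] := mean_on_avg_sqr n => <-.
by rewrite -[LHS]mul1e -integral_cst.
Qed.

Lemma weak_cvg_mean_sqr_ex : exists muS : {finite_measure set R -> \bar R},
  weak_cvg (mean_sqr_measure mu p tau sg) muS.
Proof.
have [muS _ muSE] := riesz (ltW C0) (mean_lim mean_on_avg_sqr avg_sqr_cvg).
exists muS => f cf _; rewrite muSE//.
have -> : (fun n => \int[mean_sqr_measure mu p tau sg n]_x (f x)%:E)%E =
   (fun n => (avg_sqr n f)%:E) by apply/funext => n; exact: integral_mean_sqr.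
by apply: cvg_EFin; [exact: nearW|exact: avg_sqr_cvg].
Qed.

(** The weak limit is carried by [[-C, C]] like the [mean_sqr_measure]s, so that
    clamping the test functions identifies the limit of [avg_sqr n f] for every
    continuous [f], bounded or not. *)
Lemma weak_limit_consequences (muS : {finite_measure set R -> \bar R}) :
  weak_cvg (mean_sqr_measure mu p tau sg) muS ->
  [/\ weak_cvg (mean_zero_measure p tau sg) muS,
      weak_cvg (mean_cd_measure mu p tau sg) muS &
      forall f, continuous f ->
        muS.-integrable setT (fun x => (f x)%:E) /\
        avg_zero n f @[n --> \oo] --> \int[muS]_x f x].
Proof.
move=> wm.
have [S1 tS] := weak_limit_tame (ltW C0) tame_mean_sqr mean_sqr_setT wm.
have mS : mean_on C (fun f => \int[muS]_x f x).
  exact: mean_on_integral (ltW C0) S1 tS.2.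
have lim f : continuous f -> avg_sqr n f @[n --> \oo] --> \int[muS]_x f x.
  move=> cf; pose g x := f (Num.max (- C) (Num.min C x)).
  have cg : continuous g by exact: continuous_clamp.
  have gf x : `|x| <= C -> g x = f x by move=> xC; rewrite /g clamp_id.
  have -> : (fun n => avg_sqr n f) = (fun n => avg_sqr n g).
    by apply/funext => n; apply/esym/(mean_eq (mean_on_avg_sqr n)).
  rewrite -(mean_eq mS cg cf gf).
  have := wm g cg (clamp_bounded cf (ltW C0)).
  rewrite (tame_integralE (ltW C0) tS cg).
  have -> : (fun n => \int[mean_sqr_measure mu p tau sg n]_x (g x)%:E)%E =
     (fun n => (avg_sqr n g)%:E) by apply/funext => n; exact: integral_mean_sqr.
  by move/fine_cvg.
split=> [f cf _|f cf _|f cf].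
- rewrite (tame_integralE (ltW C0) tS cf).
  have -> : (fun n => \int[mean_zero_measure p tau sg n]_x (f x)%:E)%E =
    (fun n => (avg_zero n f)%:E) by apply/funext => n; exact: integral_mean_zero.
  by apply: cvg_EFin; [exact: nearW|apply: avg_zero_cvg => //; exact: lim].
- rewrite (tame_integralE (ltW C0) tS cf).
  have -> : (fun n => \int[mean_cd_measure mu p tau sg n]_x (f x)%:E)%E =
    (fun n => (avg_cd n f)%:E) by apply/funext => n; exact: integral_mean_cd.
  by apply: cvg_EFin; [exact: nearW|apply: avg_cd_cvg; exact: lim].
- split; first exact: (tame_integrable (ltW C0) tS cf).
  by apply: avg_zero_cvg => //; exact: lim.
Qed.

End averaged.

Theorem theorem6 (R : realType)
    (mu : nat -> {finite_measure set R -> \bar R})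
    (p : nat -> nat -> {poly R}) (a b : nat -> nat -> R)
    (tau sg : nat -> {nonneg R}) (Sigma : nat -> nat -> R)
    (mu_bounded : forall k, on_bounded_interval (mu k))
    (mu_infinite : forall k, infinite_set (msupport (mu k)))
    (p_orthonormal : forall k, orthonormal_polys (mu k) (p k))
    (ab_coefs : forall k, recurrence_coefs (p k) (a k) (b k))
    (S_regular : regular_method (fun n k => (norlund_weight tau sg n k)%:num))
    (N_infty : (norlund_mean tau n)%:num @[n --> \oo] --> +oo)
    (mu_nevai : mean_nevai_class
      (fun n k => (norlund_weight tau sg n k)%:num) Sigma a b) :
  (exists muS : {finite_measure set R -> \bar R},
     weak_cvg (mean_sqr_measure mu p tau sg) muS) /\
  (forall muS : {finite_measure set R -> \bar R},
     weak_cvg (mean_sqr_measure mu p tau sg) muS ->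
     [/\ weak_cvg (mean_zero_measure p tau sg) muS,
         weak_cvg (mean_cd_measure mu p tau sg) muS &
         forall f : R -> R, continuous f ->
           muS.-integrable setT (fun x => (f x)%:E) /\
           ((norlund_mean tau n)%:num^-1 *
              \sum_(k < n.+1) (norlund_weight tau sg n k)%:num *
                 \sum_(1 <= j < k.+2) f (op_zero (p (n - k)%N) k.+1 j))
             @[n --> \oo] --> \int[muS]_x f x]).
Proof.
have [[[Ma aMa] [Mb bMb]] _ _] := mu_nevai.
have aM j l : `|a j l| <= Num.max Ma Mb by rewrite le_max aMa.
have bM j l : `|b j l| <= Num.max Ma Mb by rewrite le_max bMb orbT.
split.
  exact: (weak_cvg_mean_sqr_ex mu_bounded p_orthonormal ab_coefs S_regular
    mu_nevai aM bM).
move=> muS wm.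
have [wz wcd lim] := weak_limit_consequences mu_bounded mu_infinite p_orthonormal
  ab_coefs S_regular N_infty aM bM wm.
split=> // f cf; have [intf limf] := lim f cf; split => //.
rewrite (_ : (fun n => _) = (fun n => avg_zero p tau sg n f))//.
apply/funext => n; congr (_ * _); apply: eq_bigr => k _; congr (_ * _).
by rewrite big_add1 big_mkord.
Qed.
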